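(* Let $T=M_wEM_u$ be a weighted conditional type operator that is bounded on $L^2(\mu)$, i.e. $T\in\mathcal{B}(L^2(\mu))$, and let $n\in\mathbb{N}$. Then the following are equivalent: (1) $T$ is an $n$-quasi-contraction; (2) $T$ is a $1$-quasi-contraction; (3) $|E(uw)|\leq 1$ $\mu$-a.e.
   Context: $(X,\mathcal{F},\mu)$ is a $\sigma$-finite measure space, $\mathcal{A}\subseteq\mathcal{F}$ is a $\sigma$-subalgebra such that $(X,\mathcal{A},\mu|_{\mathcal{A}})$ is also $\sigma$-finite, and $L^p(\mu)=L^p(\mathcal{F})=L^p(X,\mathcal{F},\mu)$ (complex-valued functions). $E=E^{\mathcal{A}}$ is the conditional expectation operator: for $f\ge 0$ measurable or $f\in L^p(\mathcal{F})$, $E(f)$ is the unique $\mathcal{A}$-measurable function with $\int_A E(f)\,d\mu=\int_A f\,d\mu$ for all $A\in\mathcal{A}$ (an $\mathcal{F}$-measurable $f$ for which $E(f)$ exists is called conditionable). Weighted conditional type (WCT) operator: if $u,w:X\to\mathbb{C}$ are $\mathcal{F}$-measurable such that, for all $f\in L^p(\mathcal{F})$ ($1\le p<\infty$), $uf$ is conditionable and $wE(uf)\in L^p(\mathcal{F})$, then the WCT operator $M_wEM_u:L^p(\mathcal{F})\to L^p(\mathcal{F})$ is $f\mapsto wE(uf)$. $\mathcal{B}(Y)$ denotes the bounded linear operators on $Y$. For a complex Hilbert space $\mathcal{H}$, $T\in\mathcal{B}(\mathcal{H})$ and $n\in\mathbb{N}=\{1,2,\dots\}$, $T$ is called an $n$-quasi-contraction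 if $T^{*\,n+1}T^{n+1}\leq T^{*\,n}T^{n}$ (in the order of self-adjoint operators). *)

(* Defs.v *)
From HB Require Import structures.
From mathcomp Require Import all_boot all_order all_algebra ring_quotient.
From mathcomp Require Import all_classical all_reals all_analysis.
From mathcomp Require Import measurable_realfun.

Set Implicit Arguments.
Unset Strict Implicit.
Unset Printing Implicit Defensive.

Import Order.TTheory GRing.Theory Num.Theory.
Import numFieldNormedType.Exports.
From mathcomp Require Import complex.

Local Open Scope classical_set_scope.
Local Open Scope ring_scope.
Local Open Scope complex_scope.
Local Open Scope quotient_scope.

Section ComplexIntegration.
Context (R : realType).

Definition cmeasurable d (T : measurableType d) (f : T -> R[i]) :=
  measurable_fun setT (@Re R \o f) /\ measurable_fun setT (@Im R \o f).

Context d (T : measurableType d) (mu : {measure set T -> \bar R}).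

Definition cintegrable (D : set T) (f : T -> R[i]) :=
  mu.-integrable D (EFin \o (@Re R \o f)) /\
  mu.-integrable D (EFin \o (@Im R \o f)).

Definition cintegral (D : set T) (f : T -> R[i]) : R[i] :=
  (\int[mu]_(x in D) Re (f x)) +i* (\int[mu]_(x in D) Im (f x)).

Definition square_integrable (f : T -> R[i]) :=
  cmeasurable f /\
  (\int[mu]_x (ComplexField.Normc.normc (f x) ^+ 2)%:E < +oo)%E.

Lemma Lfun2P (f : T -> R) : f \in Lfun mu 2%:E <->
  measurable_fun setT f /\ (\int[mu]_x (f x ^+ 2)%:E < +oo)%E.
Proof.
split=> [f2|[mf foo]].
  split; first by move: f2; rewrite inE => /andP[/[!inE]].
  have /integrableP[_] := Lfun2_integrable_sqr f2; apply: le_lt_trans.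
  rewrite le_eqVlt; apply/orP; left; apply/eqP; apply: eq_integral => x _ /=.
  by rewrite ger0_norm ?sqr_ge0.
rewrite inE; apply/andP; split; rewrite inE//= /finite_norm unlock /Lnorm.
rewrite poweR_lty//=; move: foo; apply: le_lt_trans.
rewrite le_eqVlt; apply/orP; left; apply/eqP; apply: eq_integral => x _ /=.
by rewrite powR_mulrn// -normrX ger0_norm ?sqr_ge0.
Qed.

Lemma normc_sqr (z : R[i]) :
  ComplexField.Normc.normc z ^+ 2 = Re z ^+ 2 + Im z ^+ 2.
Proof. by case: z => a b /=; rewrite sqr_sqrtr ?addr_ge0 ?sqr_ge0. Qed.

Lemma square_integrableP (f : T -> R[i]) : square_integrable f <->
  (@Re R \o f \in Lfun mu 2%:E) /\ (@Im R \o f \in Lfun mu 2%:E).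
Proof.
have mR (g : T -> R) : measurable_fun setT g ->
    measurable_fun setT (EFin \o (fun x => g x ^+ 2)).
  by move=> mg; apply/measurable_EFinP; exact: measurable_funX.
have E : measurable_fun setT (@Re R \o f) -> measurable_fun setT (@Im R \o f) ->
    (\int[mu]_x (ComplexField.Normc.normc (f x) ^+ 2)%:E =
     \int[mu]_x (Re (f x) ^+ 2)%:E + \int[mu]_x (Im (f x) ^+ 2)%:E)%E.
  move=> mr mi; rewrite -ge0_integralD//; last first.
  - exact: mR mi.
  - by move=> x _; rewrite lee_fin sqr_ge0.
  - exact: mR mr.
  - by move=> x _; rewrite lee_fin sqr_ge0.
  by apply: eq_integral => x _; rewrite normc_sqr EFinD.
have P (g : T -> R) : (0 <= \int[mu]_x (g x ^+ 2)%:E)%E.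
  by apply: integral_ge0 => x _; rewrite lee_fin sqr_ge0.
split=> [[[mr mi]]|[/Lfun2P[/= mr hr] /Lfun2P[/= mi hi]]].
  rewrite E// => h; split; apply/Lfun2P; split => //; move: h; apply: le_lt_trans.
    by rewrite leeDl.
  by rewrite leeDr.
by split; [split|rewrite E// lte_add_pinfty].
Qed.

End ComplexIntegration.

Section L2.
Context (R : realType) d (T : measurableType d) (mu : {measure set T -> \bar R}).

Definition L2pred : {pred T -> R[i]} := fun f => `[< square_integrable mu f >].

Lemma L2predP (f : T -> R[i]) : f \in L2pred <->
  (@Re R \o f \in Lfun mu 2%:E) /\ (@Im R \o f \in Lfun mu 2%:E).
Proof. by rewrite -square_integrableP; split=> /asboolP. Qed.

Let l2 : (1 <= 2%:E :> \bar R)%E.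
Proof. by rewrite lee_fin ler1n. Qed.

Lemma L2pred_submod_closed : submod_closed L2pred.
Proof.
have [c0 cl] := @Lfun_submod_closed _ T R mu 2%:E l2.
split; first by apply/L2predP; split; exact: c0.
move=> [a b] f g /L2predP[fr fi] /L2predP[gr gi]; apply/L2predP; split.
  rewrite (_ : _ \o _ = a *: (@Re R \o f) + ((- b) *: (@Im R \o f) + (@Re R \o g))).
    by apply: (cl) => //; exact: cl.
  apply/funext => x /=; rewrite !fctE /=.
  by case: (f x) (g x) => [? ?] [? ?] /=; rewrite addrA /GRing.scale/= mulNr.
rewrite (_ : _ \o _ = a *: (@Im R \o f) + (b *: (@Re R \o f) + (@Im R \o g))).
  by apply: (cl) => //; exact: cl.
apply/funext => x /=; rewrite !fctE /=.
by case: (f x) (g x) => [? ?] [? ?] /=; rewrite addrA /GRing.scale/=.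
Qed.

HB.instance Definition _ :=
  GRing.isSubmodClosed.Build _ _ L2pred L2pred_submod_closed.

Record L2fun := MkL2fun { L2val :> T -> R[i]; _ : L2val \in L2pred }.

HB.instance Definition _ := [isSub for L2val].
HB.instance Definition _ := [Choice of L2fun by <:].
HB.instance Definition _ := [SubChoice_isSubLmodule of L2fun by <:].

Lemma L2valD (f g : L2fun) x : (f + g : L2fun) x = f x + g x.
Proof. by []. Qed.

Lemma L2valN (f : L2fun) x : (- f : L2fun) x = - f x.
Proof. by []. Qed.

Lemma L2valZ a (f : L2fun) x : (a *: f : L2fun) x = a * f x.
Proof. by []. Qed.

Definition ae_zero : {pred L2fun} := fun f => `[< {ae mu, forall x, f x = 0} >].

Lemma ae_zero_zmod_closed : zmod_closed ae_zero.
Proof.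
split; first by apply/asboolP; exact: aeW.
move=> f g /asboolP f0 /asboolP g0; apply/asboolP.
by apply: filterS2 f0 g0 => x fx gx; rewrite L2valD L2valN fx gx subrr.
Qed.

HB.instance Definition _ :=
  GRing.isZmodClosed.Build _ ae_zero ae_zero_zmod_closed.

(* L^2(mu) as functions modulo equality almost everywhere; L2ip below makes it
   an inner product space. *)
Definition L2 := Quotient.quot ae_zero.
HB.instance Definition _ := EqQuotient.on L2.
HB.instance Definition _ := Choice.on L2.
HB.instance Definition _ := GRing.Zmodule.on L2.

Lemma L2_eqP (f g : L2fun) :
  \pi_L2 f = \pi_L2 g <-> {ae mu, forall x, f x = g x}.
Proof.
split=> [/eqP|fg].
  rewrite -Quotient.idealrBE => /asboolP; apply: filterS => x.
  by rewrite L2valD L2valN => /eqP; rewrite subr_eq0 => /eqP.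
apply/eqP; rewrite -Quotient.idealrBE; apply/asboolP.
by apply: filterS fg => x; rewrite L2valD L2valN => ->; rewrite subrr.
Qed.

Lemma L2_piD (f g : L2fun) : \pi_L2 (f + g) = \pi_L2 f + \pi_L2 g.
Proof. by rewrite Quotient.pi_add. Qed.

Lemma L2_pi0 : \pi_L2 (0 : L2fun) = 0 :> L2.
Proof. by apply: (@addIr _ (\pi_L2 0)); rewrite -L2_piD !add0r. Qed.

Definition L2_scale (a : R[i]) (F : L2) : L2 := \pi_L2 (a *: repr F).

Lemma L2_piZ a (f : L2fun) : \pi_L2 (a *: f) = L2_scale a (\pi_L2 f).
Proof.
apply/L2_eqP; have /L2_eqP : \pi_L2 (repr (\pi_L2 f)) = \pi_L2 f by rewrite reprK.
by apply: filterS => x fx; rewrite !L2valZ fx.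
Qed.

Lemma L2_scaleA a b F : L2_scale a (L2_scale b F) = L2_scale (a * b) F.
Proof. by rewrite -[F]reprK -!L2_piZ scalerA ?reprK. Qed.

Lemma L2_scale1 : left_id 1 L2_scale.
Proof. by move=> F; rewrite -[F]reprK -!L2_piZ scale1r ?reprK. Qed.

Lemma L2_scaleDr : right_distributive L2_scale +%R.
Proof.
move=> a F G; rewrite -[F]reprK -[G]reprK -L2_piD -!L2_piZ.
by rewrite scalerDr L2_piD.
Qed.

Lemma L2_scaleDl F : {morph L2_scale^~ F : a b / a + b}.
Proof. by move=> a b; rewrite -[F]reprK -!L2_piZ scalerDl L2_piD. Qed.

HB.instance Definition _ := GRing.Zmodule_isLmodule.Build R[i] L2
  L2_scaleA L2_scale1 L2_scaleDr L2_scaleDl.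

(* The class of f; it is 0 by convention when f is not square-integrable. *)
Definition L2class (f : T -> R[i]) : L2 := \pi_L2 (insubd (0 : L2fun) f).

Definition L2ip (F G : L2) : R[i] :=
  cintegral mu setT (fun x => repr F x * (repr G x)^*).

Lemma L2fun_Re (f : L2fun) : @Re R \o f \in Lfun mu 2%:E.
Proof. by case: f => f /= /L2predP[]. Qed.

Lemma L2fun_Im (f : L2fun) : @Im R \o f \in Lfun mu 2%:E.
Proof. by case: f => f /= /L2predP[]. Qed.

Lemma ReM (z t : R[i]) : Re (z * t^*) = Re z * Re t + Im z * Im t.
Proof. by case: z t => [a b] [c e] /=; rewrite mulrN opprK. Qed.

Lemma ImM (z t : R[i]) : Im (z * t^*) = Im z * Re t - Re z * Im t.
Proof. by case: z t => [a b] [c e] /=; rewrite mulrN addrC. Qed.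

Lemma L2fun_cintegrable (f g : L2fun) :
  cintegrable mu setT (fun x => f x * (g x)^*).
Proof.
have H (h k : T -> R) : h \in Lfun mu 2%:E -> k \in Lfun mu 2%:E ->
    mu.-integrable setT (EFin \o (h \* k)).
  by move=> h2 k2; apply/Lfun1_integrable/Lfun2_mul_Lfun1.
split.
  rewrite (_ : _ \o _ = ((EFin \o ((@Re R \o f) \* (@Re R \o g))%R) \+
                        (EFin \o ((@Im R \o f) \* (@Im R \o g))%R))%E); last first.
    by apply/funext => x /=; rewrite ReM EFinD.
  by apply: integrableD => //; apply: H; rewrite ?(L2fun_Re, L2fun_Im).
rewrite (_ : _ \o _ = ((EFin \o ((@Im R \o f) \* (@Re R \o g))%R) \-
                      (EFin \o ((@Re R \o f) \* (@Im R \o g))%R))%E); last first.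
  by apply/funext => x /=; rewrite ImM EFinB.
by apply: integrableB => //; apply: H; rewrite ?(L2fun_Re, L2fun_Im).
Qed.

Lemma cintegral_ae (f g : T -> R[i]) :
  cintegrable mu setT f -> cintegrable mu setT g ->
  {ae mu, forall x, f x = g x} -> cintegral mu setT f = cintegral mu setT g.
Proof.
move=> [fr fi] [gr gi] fg; rewrite /cintegral; congr (_ +i* _); congr fine.
  apply: ae_eq_integral => //; [exact: measurable_int fr|exact: measurable_int gr|].
  by apply: filterS fg => x /= ->.
apply: ae_eq_integral => //; [exact: measurable_int fi|exact: measurable_int gi|].
by apply: filterS fg => x /= ->.
Qed.

Lemma repr_piE (f : L2fun) : {ae mu, forall x, repr (\pi_L2 f) x = f x}.
Proof. by apply/L2_eqP; rewrite reprK. Qed.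

Lemma L2ip_pi (f g : L2fun) : L2ip (\pi_L2 f) (\pi_L2 g) =
  cintegral mu setT (fun x => f x * (g x)^*).
Proof.
apply: cintegral_ae; [exact: L2fun_cintegrable|exact: L2fun_cintegrable|].
by apply: filterS2 (repr_piE f) (repr_piE g) => x -> ->.
Qed.

Lemma cintegralD (f g : T -> R[i]) :
  cintegrable mu setT f -> cintegrable mu setT g ->
  cintegral mu setT (fun x => f x + g x) =
  cintegral mu setT f + cintegral mu setT g.
Proof.
move=> [fr fi] [gr gi]; rewrite /cintegral [RHS]/=; congr (_ +i* _).
  rewrite -RintegralD//; apply: eq_Rintegral => x _.
  by case: (f x) (g x) => [? ?] [].
rewrite -RintegralD//; apply: eq_Rintegral => x _.
by case: (f x) (g x) => [? ?] [].
Qed.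

Lemma cintegralZ a (f : T -> R[i]) : cintegrable mu setT f ->
  cintegral mu setT (fun x => a * f x) = a * cintegral mu setT f.
Proof.
case: a => a b [fr fi]; rewrite /cintegral [RHS]/=.
have Z (c : R) (h : T -> R) : mu.-integrable setT (EFin \o h) ->
    mu.-integrable setT (EFin \o (fun x => c * h x)).
  by move=> /(integrableZl measurableT c).
congr (_ +i* _).
  rewrite -!RintegralZl// -RintegralB//; [|exact: Z|exact: Z].
  by apply: eq_Rintegral => x _; case: (f x).
rewrite -!RintegralZl// -RintegralD//; [|exact: Z|exact: Z].
by apply: eq_Rintegral => x _; case: (f x).
Qed.

Lemma L2ip_conj F G : L2ip F G = (L2ip G F)^*.
Proof.
have [/= Gr Gi] := L2fun_cintegrable (repr G) (repr F).
rewrite /L2ip /cintegral [RHS]/=; congr (_ +i* _).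
  by apply: eq_Rintegral => x _; rewrite !ReM mulrC [Im _ * _]mulrC.
rewrite -mulN1r -RintegralZl//; apply: eq_Rintegral => x _.
by rewrite !ImM mulN1r opprB mulrC [Re (repr F x) * _]mulrC.
Qed.

Lemma L2ip_piP a (f1 f2 g : L2fun) :
  L2ip (\pi_L2 (a *: f1 + f2)) (\pi_L2 g) =
  a * L2ip (\pi_L2 f1) (\pi_L2 g) + L2ip (\pi_L2 f2) (\pi_L2 g).
Proof.
have E : (fun x => (a *: f1 : L2fun) x * (g x)^*) =
         (fun x => a * (f1 x * (g x)^*)).
  by apply/funext => x; rewrite L2valZ mulrA.
rewrite !L2ip_pi -cintegralZ; last exact: L2fun_cintegrable.
rewrite -cintegralD; last exact: L2fun_cintegrable; last first.
  by rewrite -E; exact: L2fun_cintegrable.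
by congr cintegral; apply/funext => x; rewrite L2valD L2valZ mulrDl mulrA.
Qed.

Lemma L2ip_linearl G : GRing.linear_for ( *%R : R[i] -> R[i] -> R[i]) (L2ip^~ G).
Proof.
move=> a F1 F2; rewrite -[F1]reprK -[F2]reprK -[G]reprK -L2ip_piP.
by rewrite L2_piD L2_piZ.
Qed.

Lemma L2ip_bilinear : bilinear_for
  (GRing.Scale.Law.clone R[i] R[i] *%R _)
  (GRing.Scale.Law.clone R[i] R[i] (Num.conj \; *%R) _) L2ip.
Proof.
split=> [G|F] a F1 F2; first exact: L2ip_linearl.
rewrite L2ip_conj L2ip_linearl [L2ip F F1]L2ip_conj [L2ip F F2]L2ip_conj.
by rewrite rmorphD rmorphM.
Qed.

HB.instance Definition _ :=
  bilinear_isBilinear.Build R[i] L2 L2 R[i] _ _ L2ip L2ip_bilinear.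

Lemma L2ip_hermitian F G : L2ip F G = (-1) ^+ false * Num.conj (L2ip G F).
Proof. by rewrite expr0 mul1r L2ip_conj. Qed.

HB.instance Definition _ :=
  isHermitianSesquilinear.Build R[i] L2 false Num.conj L2ip L2ip_hermitian.

Lemma L2ip_gt0 F : F != 0 -> 0 < L2ip F F.
Proof.
move=> F0; have [/= ir ii] := L2fun_cintegrable (repr F) (repr F).
have h0 x : 0 <= Re (repr F x * (repr F x)^*).
  by rewrite ReM -!expr2 addr_ge0 ?sqr_ge0.
rewrite ltcE; apply/andP; split=> /=.
  apply/eqP; rewrite -[RHS](mul0r (fine (mu setT))) -Rintegral_cst//.
  by apply: eq_Rintegral => x _; rewrite ImM mulrC subrr.
rewrite lt_neqAle Rintegral_ge0// andbT; apply: contra F0 => /eqP /esym h.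
have : \pi_L2 (repr F) = \pi_L2 (0 : L2fun).
  apply/L2_eqP.
  have /ae_eq_integral_abs : measurable_fun setT
      (EFin \o (fun x => Re (repr F x * (repr F x)^*))).
    exact: measurable_int ir.
  move=> /(_ mu measurableT)[K _].
  have /K : (\int[mu]_x `|(Re (repr F x * (repr F x)^*))%:E| = 0)%E.
    under eq_integral do rewrite /= ger0_norm//.
    by rewrite -[LHS]fineK ?[fine _]h//; exact: integrable_fin_num.
  apply: filterS => x /(_ I)[]; rewrite ReM -!expr2 => /eqP.
  rewrite paddr_eq0 ?sqr_ge0// !sqrf_eq0 => /andP[/eqP + /eqP].
  by case: (repr F x) => a b /= -> ->.
by rewrite reprK L2_pi0 => ->.
Qed.

HB.instance Definition _ := isDotProduct.Build R[i] L2 L2ip L2ip_gt0.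

End L2.
Arguments L2ip {R d T} mu F G.
Arguments L2class {R d T} mu f.

Section Operators.
Context (R : realType) (H : lmodType R[i]) (ip : {dot H for Num.conj}).
Implicit Types A B S T : H -> H.

Definition hnorm (x : H) : R[i] := sqrtC (ip x x).

Definition bounded_operator T :=
  linear T /\ exists M : R, forall x, hnorm (T x) <= M%:C * hnorm x.

(* ip is linear in its first argument. S is unique, and it exists for every
   bounded T when H is complete. *)
Definition is_adjoint T S := forall x y, ip (T x) y = ip x (S y).

(* 0 <= z in R[i] means that z is real and nonnegative. *)
Definition op_le A B := forall x, 0 <= ip (B x - A x) x.

Definition quasi_contraction (n : nat) T := exists2 S, is_adjoint T S &
  op_le (iter n.+1 S \o iter n.+1 T) (iter n S \o iter n T).

End Operators.

Section WCT.
Context (R : realType) d (X : measurableType d) (mu : {measure set X -> \bar R}).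
Variable A : set_system X.

(* The restriction of mu to A is sigma-finite: the covering sets are in A. *)
Definition sub_sigma_finite :=
  [/\ sigma_algebra setT A, A `<=` measurable &
      sigma_finite (setT : set (g_sigma_algebraType A)) mu].

(* The sets B with f integrable on B are those for which the integral of f over
   B makes sense. The covering condition, equivalent to E|f| < +oo almost
   everywhere, makes these B numerous enough to determine g up to a null set;
   it holds for every f in L^p(mu), 1 <= p < +oo. *)
Definition is_condexp (f g : X -> R[i]) :=
  [/\ cmeasurable (g : g_sigma_algebraType A -> R[i]),
      exists2 F : (set X)^nat, \bigcup_i F i = setT &
        forall i, A (F i) /\ cintegrable mu (F i) f &
      forall B, A B -> cintegrable mu B f ->
        cintegrable mu B g /\ cintegral mu B g = cintegral mu B f].

Definition conditionable (f : X -> R[i]) :=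
  cmeasurable f /\ exists g, is_condexp f g.

(* A version of E(f); it is 0 by convention when f is not conditionable. *)
Definition condexp (f : X -> R[i]) : X -> R[i] :=
  xget (fun=> 0) [set g | is_condexp f g].

Definition wct_weights (u w : X -> R[i]) :=
  [/\ cmeasurable u, cmeasurable w &
      forall f, square_integrable mu f ->
        conditionable (u \* f) /\ square_integrable mu (w \* condexp (u \* f))].

(* M_w E M_u; the choice of the representative of F and of the version of
   E(u F) only changes functions on null sets. *)
Definition wct (u w : X -> R[i]) (F : L2 mu) : L2 mu :=
  L2class mu (w \* condexp (u \* repr F)).

End WCT.
Arguments wct {R d X} mu A u w F.

(* Main.v *)
Require Import Defs.
From HB Require Import structures.
From mathcomp Require Import all_boot all_order all_algebra.
From mathcomp Require Import all_classical all_reals all_analysis.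
From mathcomp Require Import measurable_realfun.
Import Order.TTheory GRing.Theory Num.Theory.
Import numFieldNormedType.Exports.
From mathcomp Require Import complex ring lra.

(* Write c = E(uw). Pulling A-measurable factors out of E gives T^2 F = c (T F),
   hence T^(n+1) F = c (T^n F) for n >= 1, and T is an n-quasi-contraction iff
   |T^(n+1) F| <= |T^n F| in norm for all F. If |c| <= 1 this is clear.
   Conversely choose f0 in L^2 with u f0 >= 0, positive where u <> 0, and let
   e = E(u f0). For F the class of f0 restricted to {|c| > 1}, the norm
   inequality forces w e = 0 on {|c| > 1}, so uw = 0 there since u = 0 where
   e = 0, and finally c = 0 there: the set is null.
   The function e also serves to localize: since w e is in L^2, both uw and
   w conj(g) (g in L^2), restricted to {e > 0}, are conditionable;
   this produces c, and the adjoint T* g = conj(u E(w conj(g))). That the latter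
   is in L^2 follows from the boundedness of T by truncation. *)

Set Implicit Arguments.
Unset Strict Implicit.
Unset Printing Implicit Defensive.

Local Open Scope classical_set_scope.
Local Open Scope ring_scope.

(** * Vanishing integrals over sets of [A], extended to [A]-measurable multipliers *)

Section SubSigmaAlgebra.
Context (R : realType) d (X : measurableType d) (mu : {measure set X -> \bar R}).
Context (A : set_system X) (sA : sigma_algebra setT A) (Am : A `<=` measurable).
Local Notation Y := (g_sigma_algebraType A).

Lemma sub_measurableE (B : set X) : (measurable (B : set Y)) = A B.
Proof. by rewrite /measurable/= (sigma_algebra_id sA). Qed.

Lemma sub_measurableI (B C : set X) : A B -> A C -> A (B `&` C).
Proof. by rewrite -!sub_measurableE; exact: measurableI. Qed.

Lemma sub_measurable_fun d' (Z : measurableType d') (g : X -> Z) :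
  measurable_fun setT (g : Y -> Z) -> measurable_fun setT g.
Proof.
by move=> mg _ B mB; apply: Am; rewrite -sub_measurableE; exact: mg.
Qed.

Local Open Scope ereal_scope.
Import HBNNSimple.

(** The level sets of [g] belong to [A], so [g * h] is a finite combination of restrictions of [h]
    to sets of [A], each with integral zero over [D]. *)
Lemma integral0_mul_simple (D : set X) (h : X -> R) (g : {nnsfun Y >-> R}) :
  A D -> mu.-integrable D (EFin \o h) ->
  (forall B, A B -> B `<=` D -> \int[mu]_(x in B) (h x)%:E = 0) ->
  \int[mu]_(x in D) (g x * h x)%:E = 0.
Proof.
move=> mD ih h0; have mD' := Am mD.
have mg y : A (g @^-1` [set y]) by rewrite -sub_measurableE; exact: measurable_sfunP.
pose k (y : R) x := (y * (\1_(g @^-1` [set y]) x * h x))%:E.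
have kE y x : k y x = y%:E * ((EFin \o h) \_ (g @^-1` [set y])) x.
  rewrite /k EFinM patchE indicE; case: ifP => _; first by rewrite mul1r.
  by rewrite mul0r.
have ki y : mu.-integrable D (k y).
  have -> : k y = fun x => y%:E * ((EFin \o h) \_ (g @^-1` [set y])) x.
    by apply/funext => x; rewrite kE.
  apply: integrableZl => //; apply/integrable_restrict => //.
    exact: Am.
  by apply: integrableS ih => //; apply: measurableI => //; exact: Am.
transitivity (\int[mu]_(x in D) (\sum_(y <- finmap.enum_fset (fset_set (range g))) k y x)).
  apply: eq_integral => x _; rewrite fimfunE fsbig_finite//= sumEFin mulr_suml.
  by congr EFin; apply: eq_bigr => y _; rewrite mulrA.
rewrite integral_sum//; apply: big1 => y _.
under eq_integral do rewrite kE.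
rewrite integralZl//; last first.
  apply/integrable_restrict => //; first exact: Am.
  by apply: integrableS ih => //; apply: measurableI => //; exact: Am.
rewrite -integral_mkcondr h0 ?mule0//; exact: sub_measurableI.
Qed.


(** The positive and negative parts of [a] are approximated from below by simple functions;
    integrability of [a * h] provides the domination. *)
Lemma integral0_mul (D : set X) (h : X -> R) (a : X -> R) :
  A D -> mu.-integrable D (EFin \o h) ->
  (forall B, A B -> B `<=` D -> \int[mu]_(x in B) (h x)%:E = 0) ->
  measurable_fun setT (a : Y -> R) ->
  mu.-integrable D (fun x => (a x * h x)%:E) ->
  \int[mu]_(x in D) (a x * h x)%:E = 0.
Proof.
move=> mD ih h0 ma iah; have mD' := Am mD.
have mh : measurable_fun D h by apply/measurable_EFinP; exact: measurable_int ih.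
suff pos (b : X -> R) : measurable_fun setT (b : Y -> R) -> (forall x, 0 <= b x)%R ->
    (forall x, b x <= `|a x|)%R ->
    mu.-integrable D (fun x => (b x * h x)%:E) /\
    \int[mu]_(x in D) (b x * h x)%:E = 0.
  have [ip p0] : mu.-integrable D (fun x => (a^\+ x * h x)%:E)%R /\
      \int[mu]_(x in D) (a^\+ x * h x)%:E%R = 0.
    apply: pos => [|x|x]; first exact: measurable_funrpos.
      exact: funrpos_ge0.
    by rewrite -/((Num.norm \o a) x) -funrposDneg lerDl funrneg_ge0.
  have [im m0] : mu.-integrable D (fun x => (a^\- x * h x)%:E)%R /\
      \int[mu]_(x in D) (a^\- x * h x)%:E%R = 0.
    apply: pos => [|x|x]; first exact: measurable_funrneg.
      exact: funrneg_ge0.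
    by rewrite -/((Num.norm \o a) x) -funrposDneg lerDr funrpos_ge0.
  transitivity (\int[mu]_(x in D) ((a^\+ x * h x)%:E - (a^\- x * h x)%:E)%E).
    apply: eq_integral => x _; rewrite -EFinB -mulrBl; congr (_ * _)%:E.
    by rewrite -[in LHS](funrposBneg a).
  by rewrite integralB// p0 m0 sube0.
move=> mb b0 ba.
have mb' : measurable_fun D b.
  by apply: measurable_funTS; exact: sub_measurable_fun.
have ib : mu.-integrable D (fun x => (b x * h x)%:E).
  apply: le_integrable iah => //.
    by apply/measurable_EFinP; exact: measurable_funM.
  move=> x _ /=; rewrite lee_fin !normrM ler_wpM2r//.
  by rewrite ger0_norm.
split => //.
have meb : measurable_fun setT (EFin \o b : Y -> \bar R) by apply/measurable_EFinP.
(* The approximation is taken on [Y], so that the simple functions [g n] are [A]-measurable. *)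
pose g := nnsfun_approx measurableT meb.
have gb n x : (0 <= g n x <= b x)%R.
  apply/andP; split; first exact: fun_ge0.
  rewrite /g nnsfun_approxE -lee_fin; apply: le_approx => //.
  by move=> y _; rewrite lee_fin.
have mg n : measurable_fun D (fun x => (g n x * h x)%:E).
  apply/measurable_EFinP; apply: measurable_funM => //.
  by apply/measurable_funTS/sub_measurable_fun; exact: measurable_funP.
have gbh : {ae mu, forall x, D x -> (g n x * h x)%:E @[n --> \oo] --> (b x * h x)%:E}.
  apply: aeW => x _ /=.
  have : EFin \o g ^~ x @ \oo --> (b x)%:E.
    by apply: (cvg_nnsfun_approx measurableT meb) => // y _; rewrite lee_fin.
  move=> /fine_cvgP [_ /= gx]; apply: cvg_EFin; first exact: nearW.
  exact: cvgMr_tmp.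
have gle : {ae mu, forall x n, D x -> `|(g n x * h x)%:E| <= `|(b x * h x)%:E|}.
  apply: aeW => x n _ /=; rewrite lee_fin !normrM ler_wpM2r//.
  by have /andP[? ?] := gb n x; rewrite !ger0_norm.
have [_ _] := dominated_convergence mD' mg (measurable_int _ ib) gbh
  (integrable_abse ib) gle.
have g0 n : \int[mu]_(x in D) (g n x * h x)%:E = 0 by exact: integral0_mul_simple.
under eq_fun do rewrite /= g0.
move=> cv; apply/esym.
have c0 : (fun=> 0 : \bar R) @ \oo --> (0 : \bar R) by exact: cvg_cst.
exact: (cvg_unique (@ereal_hausdorff R) c0 cv).
Qed.

End SubSigmaAlgebra.

(** * Real conditional expectations localized along exhaustions *)

Section LocalCondexp.
Context (R : realType) d (X : measurableType d) (mu : {measure set X -> \bar R}).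
Context (A : set_system X) (sA : sigma_algebra setT A) (Am : A `<=` measurable).
Local Notation Y := (g_sigma_algebraType A).
Local Open Scope ereal_scope.

Definition exhaustion (F : (set X)^nat) :=
  [/\ nondecreasing_seq F, \bigcup_i F i = setT & forall i, A (F i)].

Lemma exhaustionI F G : exhaustion F -> exhaustion G ->
  exhaustion (fun i => F i `&` G i).
Proof.
move=> [ndF UF AF] [ndG UG AG]; split=> [m n mn| |i].
- have /subsetPset FS := ndF _ _ mn; have /subsetPset GS := ndG _ _ mn.
  by apply/subsetPset => x [/FS ? /GS ?].
- apply/seteqP; split=> // x _.
  have [m _ Fm] : (\bigcup_i F i) x by rewrite UF.
  have [n _ Gn] : (\bigcup_i G i) x by rewrite UG.
  exists (maxn m n) => //; split.
    by have /subsetPset := ndF _ _ (leq_maxl m n); exact.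
  by have /subsetPset := ndG _ _ (leq_maxr m n); exact.
- exact: sub_measurableI.
Qed.

(** Supplies sets of [A] on which [a] is bounded, so that multiplication by [a] keeps integrability
    there. *)
Lemma exhaustion_le (a : X -> R) : measurable_fun setT (a : Y -> R) ->
  exhaustion (fun i => [set x | `|a x| <= i%:R]%R).
Proof.
move=> ma; split=> [m n mn| |i].
- by apply/subsetPset => x /= /le_trans; apply; rewrite ler_nat.
- apply/seteqP; split=> // x _; exists (Num.truncn `|a x|%R).+1 => //=.
  by rewrite ltW// truncnS_gt.
- rewrite -(sub_measurableE sA).
  rewrite -[X in measurable X]setTI; apply: (measurable_fun_le _ _ _) => //.
  exact: measurableT_comp.
Qed.

(* g is a version of E(f): the integrals are only compared inside an exhaustion
   by sets of A on which f and g are integrable, so that f need not be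
   integrable on X. *)
Definition lce (f g : X -> R) :=
  [/\ measurable_fun setT f, measurable_fun setT (g : Y -> R) &
  exists2 F, exhaustion F & forall i,
    [/\ mu.-integrable (F i) (EFin \o f), mu.-integrable (F i) (EFin \o g) &
     forall B, A B -> B `<=` F i ->
       \int[mu]_(x in B) (f x)%:E = \int[mu]_(x in B) (g x)%:E]].

(** Intersecting with the sets [|a| <= i] makes both products integrable. Since [f - g] has zero
    integral over every set of [A] inside, [integral0_mul] applies to [a] times [f - g]. *)
Lemma lceM (a f g : X -> R) : measurable_fun setT (a : Y -> R) -> lce f g ->
  lce (a \* f)%R (a \* g)%R.
Proof.
move=> ma [mf mg [F eF FE]].
have ma' := sub_measurable_fun sA Am ma.
split; [exact: measurable_funM|exact: measurable_funM|].
exists (fun i => F i `&` [set x | `|a x| <= i%:R]%R).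
  by apply: exhaustionI => //; exact: exhaustion_le.
have [_ _ AF] := eF; have [_ _ Aa] := exhaustion_le ma.
have mI i : measurable (F i `&` [set x | `|a x| <= i%:R]%R).
  by apply: measurableI; exact: Am.
have bd (k : X -> R) i : measurable_fun setT k -> mu.-integrable (F i) (EFin \o k) ->
    mu.-integrable (F i `&` [set x | `|a x| <= i%:R]%R) (EFin \o (a \* k)%R).
  move=> mk ik; apply: (@le_integrable _ _ _ _ _ (mI i) _ (fun x => i%:R%:E * (k x)%:E)).
  - by apply/measurable_EFinP/measurable_funTS; exact: measurable_funM.
  - move=> x [_ /= ai]; rewrite lee_fin !normrM ler_wpM2r//.
    by rewrite (le_trans ai)// ler_norm.
  - apply: integrableZl => //.
    by apply: integrableS ik => //; exact: Am.
move=> i; have [fi gi fg] := FE i.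
have mgX := sub_measurable_fun sA Am mg.
have iaf := bd _ _ mf fi; have iag := bd _ _ mgX gi.
split => // B AB BF.
have iB k : mu.-integrable (F i `&` [set x | `|a x| <= i%:R]%R) k ->
  mu.-integrable B k by apply: integrableS => //; exact: Am.
have iB' k : mu.-integrable (F i) k -> mu.-integrable B k.
  by apply: integrableS => //; [exact: Am|exact: Am|exact: subset_trans BF (@subIsetl _ _ _)].
have finB k : mu.-integrable B k -> \int[mu]_(x in B) k x \is a fin_num.
  by apply: integrable_fin_num; exact: Am.
have finaf := finB _ (iB _ iaf); have finag := finB _ (iB _ iag).
suff /eqP : \int[mu]_(x in B) ((a \* f) x)%:E - \int[mu]_(x in B) ((a \* g) x)%:E = 0.
  by rewrite sube_eq ?add0e ?fin_num_adde_defl// => /eqP.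
rewrite -integralB//; [|exact: Am|exact: iB|exact: iB].
have E : (EFin \o (a \* f)%R) \- (EFin \o (a \* g)%R) =
    fun x => (a x * (f x - g x))%:E.
  by apply/funext => x /=; rewrite -EFinB mulrBr.
have -> : \int[mu]_(x in B) ((a x * f x)%:E - (a x * g x)%:E) =
    \int[mu]_(x in B) (a x * (f x - g x))%:E.
  by apply: eq_integral => x _; rewrite -EFinB mulrBr.
apply: (integral0_mul sA Am AB) => //.
- have -> : EFin \o (fun x => f x - g x)%R = (EFin \o f) \- (EFin \o g).
    by apply/funext => x /=; rewrite EFinB.
  by apply: integrableB; [exact: Am|exact: iB'|exact: iB'].
- move=> C AC CB.
  have iC k : mu.-integrable B k -> mu.-integrable C k.
    by apply: integrableS => //; exact: Am.
  under eq_integral do rewrite EFinB.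
  rewrite integralB//; [|exact: Am|exact/iC/iB'|exact/iC/iB'].
  rewrite fg ?subee//; last first.
    by apply: subset_trans CB _; apply: subset_trans BF _; exact: subIsetl.
  by apply: integrable_fin_num; [exact: Am|exact/iC/iB'].
- by rewrite -E; apply: integrableB; [exact: Am|exact: iB|exact: iB].
Qed.

Lemma lceD (f f' g g' : X -> R) : lce f g -> lce f' g' ->
  lce (fun x => f x + f' x)%R (fun x => g x + g' x)%R.
Proof.
move=> [mf mg [F eF FE]] [mf' mg' [G eG GE]].
split; [exact: measurable_funD|exact: measurable_funD|].
exists (fun i => F i `&` G i); first exact: exhaustionI.
have [_ _ AF] := eF; have [_ _ AG] := eG.
move=> i; have [fi gi fg] := FE i; have [fi' gi' fg'] := GE i.
have mI : measurable (F i `&` G i) by apply: measurableI; exact: Am.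
have l k C : A C -> C `<=` F i `&` G i ->
    mu.-integrable (F i) k -> mu.-integrable C k.
  by move=> AC CI; apply: integrableS; [exact: Am|exact: Am|move=> x /CI[]].
have r k C : A C -> C `<=` F i `&` G i ->
    mu.-integrable (G i) k -> mu.-integrable C k.
  by move=> AC CI; apply: integrableS; [exact: Am|exact: Am|move=> x /CI[]].
have AI : A (F i `&` G i) by exact: sub_measurableI.
have D (k k' : X -> R) : EFin \o (fun x => k x + k' x)%R = (EFin \o k) \+ (EFin \o k').
  by apply/funext => x /=; rewrite EFinD.
split.
- by rewrite D; apply: integrableD => //; [exact: l fi|exact: r fi'].
- by rewrite D; apply: integrableD => //; [exact: l gi|exact: r gi'].
- move=> B AB BI.
  under eq_integral do rewrite EFinD.
  under [RHS]eq_integral do rewrite EFinD.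
  have mB := Am AB.
  rewrite !integralD//; [|exact: l gi|exact: r gi'|exact: l fi|exact: r fi'].
  by rewrite fg ?fg'// => x /BI[].
Qed.

Lemma lceB (f f' g g' : X -> R) : lce f g -> lce f' g' ->
  lce (fun x => f x - f' x)%R (fun x => g x - g' x)%R.
Proof.
move=> fg /(@lceM (fun=> -1)%R); move=> /(_ (measurable_cst _)) fg'.
have := lceD fg fg'; congr lce; apply/funext => x /=; by rewrite mulN1r.
Qed.

Lemma lce_ae (f f' g : X -> R) : measurable_fun setT f' ->
  {ae mu, forall x, f x = f' x} -> lce f g -> lce f' g.
Proof.
move=> mf' ff' [mf mg [F eF FE]]; split => //; exists F => // i.
have [fi gi fg] := FE i; have [_ _ AF] := eF.
have mfB B : measurable_fun B (EFin \o f).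
  by apply/measurable_EFinP; exact: measurable_funTS.
have mfB' B : measurable_fun B (EFin \o f').
  by apply/measurable_EFinP; exact: measurable_funTS.
split => //; last first.
  move=> B AB BF; rewrite -fg//; apply: ae_eq_integral => //; first exact: Am.
  by apply: filterS ff' => x /= ->.
apply/integrableP; split => //.
case/integrableP: fi => _; apply: le_lt_trans; rewrite le_eqVlt; apply/orP; left.
apply/eqP; apply: ge0_ae_eq_integral => //; first exact: Am.
- exact: measurableT_comp.
- exact: measurableT_comp.
- by apply: filterS ff' => x /= ->.
Qed.

(** The value at a zero of [g] is 1, so that the absolute value is 1 everywhere. *)
Definition sign_of (g : X -> R) (x : X) : R := (2 * \1_[set x | 0 <= g x]%R x - 1)%R.

Lemma sign_ofE g x : (sign_of g x * g x = `|g x|)%R.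
Proof.
rewrite /sign_of indicE; have [g0|g0] := leP 0%R (g x).
  by rewrite mem_set//= mulr1 ger0_norm// -[2%R]/(1 + 1)%R addrK mul1r.
by rewrite memNset/= ?mulr0 ?sub0r ?mulN1r ?ltr0_norm//; apply/negP; rewrite -ltNge.
Qed.

Lemma normr_sign_of g x : (`|sign_of g x| = 1)%R.
Proof.
rewrite /sign_of indicE; case: (_ \in _) => /=.
  by rewrite mulr1 -[2%R]/(1 + 1)%R addrK normr1.
by rewrite mulr0 sub0r normrN normr1.
Qed.

Lemma measurable_sign_of g : measurable_fun setT (g : Y -> R) ->
  measurable_fun setT (sign_of g : Y -> R).
Proof.
move=> mg; apply: measurable_funB => //; apply: measurable_funM => //.
apply: measurable_indic; rewrite -[X in measurable X]setTI.
exact: (measurable_fun_le _ _ _).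
Qed.

(** Pulling out the sign turns [g] into [|g|], which allows estimates of [|g|] by [|f|]. *)
Lemma lce_sign (f g : X -> R) : lce f g ->
  lce (sign_of g \* f)%R (fun x => `|g x|)%R.
Proof.
move=> fg; have [_ mg _] := fg.
have := lceM (measurable_sign_of mg) fg.
by congr lce; apply/funext => x; rewrite /= sign_ofE.
Qed.

(** By [lce_sign], the integral of [|g|] over each set of an exhaustion is zero. *)
Lemma lce0_ae (g : X -> R) : lce (fun=> 0)%R g -> {ae mu, forall x, g x = 0%R}.
Proof.
move=> g0; have [_ mg _] := g0.
have mgX := sub_measurable_fun sA Am mg.
have [_ _ [F [ndF UF AF] FE]] := lce_sign g0.
have gF i : {ae mu, forall x, F i x -> g x = 0%R}.
  have mF := Am (AF i).
  have [_ _ /(_ (F i) (AF i) (@subset_refl _ _)) E] := FE i.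
  have mgF : measurable_fun (F i) (EFin \o g).
    by apply/measurable_EFinP; exact: measurable_funTS.
  have [+ _] := ae_eq_integral_abs mu mF mgF.
  have -> : \int[mu]_(x in F i) `|(EFin \o g) x| = 0.
    rewrite /= -E; apply: integral0_eq => x _ /=; by rewrite mulr0.
  by move=> /(_ erefl); apply: filterS => x /= h /h[].
have := ae_foralln gF; apply: filterS => x h.
have [i _ Fi] : (\bigcup_i F i) x by rewrite UF.
exact: h Fi.
Qed.

Lemma lce_uniq (f f' g g' : X -> R) : {ae mu, forall x, f x = f' x} ->
  lce f g -> lce f' g' -> {ae mu, forall x, g x = g' x}.
Proof.
move=> ff' fg fg'; have [mf' _ _] := fg'.
have := lceB (lce_ae mf' ff' fg) fg'.
have -> : (fun x => f' x - f' x)%R = (fun=> 0)%R.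
  by apply/funext => x; rewrite subrr.
by move=> /lce0_ae; apply: filterS => x /eqP; rewrite subr_eq0 => /eqP.
Qed.

Lemma cvg_integral_nondecreasing_set (F : (set X)^nat) (D : set X) (f : X -> R) :
  nondecreasing_seq F -> (forall i, measurable (F i)) -> D = \bigcup_i F i ->
  mu.-integrable D (EFin \o f) ->
  \int[mu]_(x in F i) (f x)%:E @[i --> \oo] --> \int[mu]_(x in D) (f x)%:E.
Proof.
move=> ndF mF DE iD.
have mD : measurable D by rewrite DE; exact: bigcup_measurable.
have FD i : F i `<=` D by rewrite DE; exact: bigcup_sup.
have me i : measurable_fun (F i) (EFin \o f).
  by apply: measurable_funS (measurable_int _ iD).
under eq_fun do rewrite integralE.
rewrite integralE; apply: cvgeB.
- rewrite fin_num_adde_defl// fin_numN; exact: integrable_neg_fin_num iD.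
- rewrite DE; apply: ge0_nondecreasing_set_cvg_integral => // i.
  exact: measurable_funepos (me i).
- rewrite DE; apply: ge0_nondecreasing_set_cvg_integral => // i.
  exact: measurable_funeneg (me i).
Qed.

(** Passes from an exhaustion to any set [B] of [A] on which [f] is integrable: the integrals over
    the intersections with [B] converge to those over [B]. *)
Lemma lce_glue (f g : X -> R) (B : set X) : lce f g -> A B ->
  mu.-integrable B (EFin \o f) ->
  mu.-integrable B (EFin \o g) /\
  \int[mu]_(x in B) (g x)%:E = \int[mu]_(x in B) (f x)%:E.
Proof.
move=> fg AB iB; have [mf mg [F [ndF UF AF] FE]] := fg; have mB := Am AB.
have mgX := sub_measurable_fun sA Am mg.
have nd (G : (set X)^nat) : nondecreasing_seq G -> nondecreasing_seq (fun i => B `&` G i).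
  move=> ndG m n mn; have /subsetPset GS := ndG _ _ mn.
  by apply/subsetPset => x [? /GS ?].
have UB (G : (set X)^nat) : \bigcup_i G i = setT -> B = \bigcup_i (B `&` G i).
  by move=> UG; rewrite -setI_bigcupr UG setIT.
(* Over the intersection of [B] with [G i], the integral of [|g|] is that of [sign_of g * f], hence
   at most the integral of [|f|] over [B]; monotone convergence concludes. *)
have ig : mu.-integrable B (EFin \o g).
  have [ms _ [G [ndG UG AG] GE]] := lce_sign fg.
  have mBG i : measurable (B `&` G i) by apply: measurableI => //; exact: Am.
  apply/integrableP; split; first by apply/measurable_EFinP; exact: measurable_funTS.
  have mag : measurable_fun setT (fun x => `|(EFin \o g) x|).
    by apply: measurableT_comp => //; exact/measurable_EFinP.
  have maf : measurable_fun setT (fun x => `|(EFin \o f) x|).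
    by apply: measurableT_comp => //; exact/measurable_EFinP.
  case/integrableP: (iB) => _; apply: le_lt_trans.
  have cv : \int[mu]_(x in B `&` G i) `|(EFin \o g) x| @[i --> \oo] -->
      \int[mu]_(x in B) `|(EFin \o g) x|.
    rewrite {2}(UB _ UG); apply: ge0_nondecreasing_set_cvg_integral => //.
      exact: nd.
    by move=> i; exact: measurable_funTS.
  rewrite -(cvg_lim _ cv)//; apply: lime_le; first by apply/cvg_ex; eexists; exact: cv.
  apply: nearW => i; have [_ _ E] := GE i.
  have {}E := E (B `&` G i) (sub_measurableI sA AB (AG i)) (@subIsetr _ _ _).
  rewrite /= -E; apply: (@le_trans _ _ (\int[mu]_(x in B `&` G i) `|(f x)%:E|)).
    apply: le_trans (lee_abs _) _; apply: le_trans (le_abse_integral _ _ _) _ => //.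
      by apply/measurable_EFinP; exact: measurable_funTS.
    by under eq_integral do rewrite /= normrM normr_sign_of mul1r.
  by apply: ge0_subset_integral => //; exact: measurable_funTS.
split => //.
have mBF i : measurable (B `&` F i) by apply: measurableI => //; exact: Am.
have E i : \int[mu]_(x in B `&` F i) (f x)%:E = \int[mu]_(x in B `&` F i) (g x)%:E.
  by have [_ _ H] := FE i; apply: H; [exact: sub_measurableI|exact: subIsetr].
have := cvg_integral_nondecreasing_set (nd _ ndF) mBF (UB _ UF) iB.
under eq_fun do rewrite E.
have := cvg_integral_nondecreasing_set (nd _ ndF) mBF (UB _ UF) ig.
exact: (cvg_unique (@ereal_hausdorff R)).
Qed.

End LocalCondexp.

(** * Existence of conditional expectations by the Radon-Nikodym theorem *)

Section Existence.
Context (R : realType) d (X : measurableType d) (mu : {measure set X -> \bar R}).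
Context (A : set_system X) (hA : sub_sigma_finite mu A).
Local Notation Y := (g_sigma_algebraType A).
Local Open Scope ereal_scope.

Lemma sub_sigma_algebra_of : sigma_algebra setT A. Proof. by case: hA. Qed.
Lemma sub_subset_measurable : A `<=` measurable. Proof. by case: hA. Qed.

Lemma sub_measurable (B : set X) : measurable (B : set Y) -> measurable B.
Proof.
by rewrite (sub_measurableE sub_sigma_algebra_of); exact: sub_subset_measurable.
Qed.

(* hA is an argument only to let the canonical structures below depend on it. *)
Definition restr_measure of sub_sigma_finite mu A : set Y -> \bar R := mu.

Let restr_measure0 : restr_measure hA set0 = 0.
Proof. exact: (measure0 mu). Qed.

Let restr_measure_ge0 B : 0 <= restr_measure hA B.
Proof. exact: measure_ge0. Qed.

Let restr_measure_sigma_additive : semi_sigma_additive (restr_measure hA).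
Proof.
move=> F mF tF mUF; apply: (@measure_semi_sigma_additive _ _ _ mu) => //.
  by move=> i; exact: sub_measurable.
exact: sub_measurable.
Qed.

HB.instance Definition _ := isMeasure.Build _ Y R (restr_measure hA)
  restr_measure0 restr_measure_ge0 restr_measure_sigma_additive.

Let restr_measure_sigma_finite : sigma_finite setT (restr_measure hA).
Proof. by case: hA. Qed.

HB.instance Definition _ := @Measure_isSigmaFinite.Build _ Y R (restr_measure hA)
  restr_measure_sigma_finite.

(** The signed measure with density [v], restricted to [A]. *)
Definition restr_charge of sub_sigma_finite mu A := fun (v : X -> \bar R)
  (iv : mu.-integrable setT v) (B : set Y) => \int[mu]_(x in B) v x.

Section restr_charge.
Context (v : X -> \bar R) (iv : mu.-integrable setT v).

Let restr_charge0 : restr_charge hA iv set0 = 0.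
Proof. exact: integral_set0. Qed.

Let restr_charge_fin B : measurable B -> restr_charge hA iv B \is a fin_num.
Proof.
move=> /sub_measurable mB; apply: integrable_fin_num => //.
exact: integrableS iv.
Qed.

Let restr_charge_sigma_additive : semi_sigma_additive (restr_charge hA iv).
Proof.
move=> F mF tF mUF.
apply: (@charge_semi_sigma_additive _ _ _ (induced_charge iv)) => //.
  by move=> i; exact: sub_measurable.
exact: sub_measurable.
Qed.

HB.instance Definition _ := isCharge.Build _ Y R (restr_charge hA iv)
  restr_charge0 restr_charge_fin restr_charge_sigma_additive.

Lemma restr_charge_dominated : restr_charge hA iv `<< restr_measure hA.
Proof.
apply/null_content_dominatesP => B mB B0.
apply: null_set_integral => //; first exact: sub_measurable.
apply: (measurable_funS measurableT) => //; exact: measurable_int iv.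
Qed.

End restr_charge.

(** The identity from [X] to [Y] pushes [mu] forward to its restriction, so that integrals can be
    transferred between the two measures. *)
Lemma measurable_to_sub : measurable_fun setT (id : X -> Y).
Proof. by move=> _ B mB; rewrite setTI; exact: sub_measurable. Qed.

(** The Radon-Nikodym derivative of the restricted charge with respect to the restricted measure is
    the version sought. Everything is integrable over [X], hence the constant exhaustion. *)
Lemma lce_exists (v : X -> R) : mu.-integrable setT (EFin \o v) ->
  exists V, lce mu A v V.
Proof.
move=> iv.
pose nu : {charge set Y -> \bar R} := restr_charge hA iv.
pose m : {sigma_finite_measure set Y -> \bar R} := restr_measure hA.
have dom : nu `<< m by exact: restr_charge_dominated.
pose f := Radon_Nikodym nu m.
have ffin x : f x \is a fin_num by exact: Radon_Nikodym_fin_num.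
have fint : m.-integrable setT f by exact: Radon_Nikodym_integrable.
have mf : measurable_fun setT f by exact: measurable_int fint.
have mfX : measurable_fun setT (f : X -> \bar R).
  by apply: (sub_measurable_fun sub_sigma_algebra_of sub_subset_measurable).
have fX : mu.-integrable setT (f : X -> \bar R).
  apply/integrableP; split => //.
  have /integrableP[_] := fint; apply: le_lt_trans; rewrite le_eqVlt.
  apply/orP; left; apply/eqP.
  apply/esym; apply: (ge0_integral_pushforward measurable_to_sub mu (D := setT)
    (f := abse \o f)) => //.
    exact: measurableT_comp.
  by move=> y _; exact: abse_ge0.
have fE B : A B -> \int[mu]_(x in B) f x = \int[m]_(x in B) f x.
  move=> AB; apply/esym; apply: (integral_pushforward measurable_to_sub mf) => //.
    by apply: integrableS fX => //; exact: sub_subset_measurable.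
  by rewrite (sub_measurableE sub_sigma_algebra_of).
have EV : EFin \o (fine \o f) = f by apply/funext => x /=; rewrite fineK.
exists (fine \o f); split.
- exact/measurable_EFinP/(measurable_int _ iv).
- by apply/measurable_EFinP; rewrite EV.
- exists (fun=> setT).
    split => //; first by rewrite bigcup_const.
    by move=> _; rewrite -(sub_measurableE sub_sigma_algebra_of).
  move=> i; split => //; first by rewrite EV.
  move=> B AB _; under [RHS]eq_integral do rewrite /= fineK//.
  rewrite fE// -Radon_Nikodym_integral//.
  by rewrite (sub_measurableE sub_sigma_algebra_of).
Qed.

End Existence.

(** * Complex conditional expectations and their agreement with [is_condexp] *)

Section ComplexLocalCondexp.
Context (R : realType) d (X : measurableType d) (mu : {measure set X -> \bar R}).
Context (A : set_system X) (sA : sigma_algebra setT A) (Am : A `<=` measurable).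
Local Notation Y := (g_sigma_algebraType A).

Definition clce (f g : X -> R[i]) :=
  lce mu A (@Re R \o f) (@Re R \o g) /\ lce mu A (@Im R \o f) (@Im R \o g).

Lemma ReME (z t : R[i]) : Re (z * t) = Re z * Re t - Im z * Im t.
Proof. by case: z t => [a b] []. Qed.

Lemma ImME (z t : R[i]) : Im (z * t) = Re z * Im t + Im z * Re t.
Proof. by case: z t => [a b] []. Qed.

Lemma cmeasurableM d' (T : measurableType d') (f g : T -> R[i]) :
  cmeasurable f -> cmeasurable g -> cmeasurable (f \* g).
Proof.
move=> [fr fi] [gr gi]; split.
  rewrite (_ : _ \o _ = (@Re R \o f) \* (@Re R \o g) \- (@Im R \o f) \* (@Im R \o g)).
    by apply: measurable_funB; exact: measurable_funM.
  by apply/funext => x /=; rewrite ReME.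
rewrite (_ : _ \o _ = (@Re R \o f) \* (@Im R \o g) \+ (@Im R \o f) \* (@Re R \o g)).
  by apply: measurable_funD; exact: measurable_funM.
by apply/funext => x /=; rewrite ImME.
Qed.

Lemma clceM (a f g : X -> R[i]) : cmeasurable (a : Y -> R[i]) -> clce f g ->
  clce (a \* f) (a \* g).
Proof.
move=> [ar ai] [fg_r fg_i]; split.
  have := lceB sA Am (lceM sA Am ar fg_r) (lceM sA Am ai fg_i).
  by congr lce; apply/funext => x /=; rewrite ReME.
have := lceD sA Am (lceM sA Am ar fg_i) (lceM sA Am ai fg_r).
by congr lce; apply/funext => x /=; rewrite ImME.
Qed.

Lemma clce_ae (f f' g : X -> R[i]) : cmeasurable f' ->
  {ae mu, forall x, f x = f' x} -> clce f g -> clce f' g.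
Proof.
move=> [fr fi] ff' [hr hi]; split.
  by apply: lce_ae hr => //; apply: filterS ff' => x /= ->.
by apply: lce_ae hi => //; apply: filterS ff' => x /= ->.
Qed.

Lemma clce_uniq (f f' g g' : X -> R[i]) : {ae mu, forall x, f x = f' x} ->
  clce f g -> clce f' g' -> {ae mu, forall x, g x = g' x}.
Proof.
move=> ff' [hr hi] [hr' hi'].
have er : {ae mu, forall x, Re (g x) = Re (g' x)}.
  by apply: (lce_uniq sA Am _ hr hr'); apply: filterS ff' => x /= ->.
have ei : {ae mu, forall x, Im (g x) = Im (g' x)}.
  by apply: (lce_uniq sA Am _ hi hi'); apply: filterS ff' => x /= ->.
apply: filterS2 er ei => x.
by case: (g x) (g' x) => [a b] [c e] /= -> ->.
Qed.

Lemma clce_cmeasurable (f g : X -> R[i]) : clce f g ->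
  cmeasurable f /\ cmeasurable (g : Y -> R[i]).
Proof. by move=> [[? ? _] [? ? _]]. Qed.

Lemma clce_glue (f g : X -> R[i]) (B : set X) : clce f g -> A B ->
  cintegrable mu B f ->
  cintegrable mu B g /\ cintegral mu B g = cintegral mu B f.
Proof.
move=> [hr hi] AB [ir ii].
have [? er] := lce_glue sA Am hr AB ir; have [? ei] := lce_glue sA Am hi AB ii.
by split => //; rewrite /cintegral; congr (_ +i* _)%C; congr fine.
Qed.

Lemma integrable_setU (B C : set X) (f : X -> \bar R) :
  measurable B -> measurable C ->
  mu.-integrable B f -> mu.-integrable C f -> mu.-integrable (B `|` C) f.
Proof.
move=> mB mC iB iC.
have mf : measurable_fun (B `|` C) f.
  by apply/measurable_funU => //; split; [exact: measurable_int iB|exact: measurable_int iC].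
have mBC := measurableU _ _ mB mC.
apply/(integrable_mkcond _ mBC).
have jB : mu.-integrable setT (abse \o (f \_ B))%E.
  by apply: integrable_abse; apply/(integrable_mkcond _ mB).
have jC : mu.-integrable setT (abse \o (f \_ C))%E.
  by apply: integrable_abse; apply/(integrable_mkcond _ mC).
apply: (le_integrable measurableT _ _ (integrableD measurableT jB jC)).
  by apply/(measurable_restrictT _ mBC).
move=> x _ /=; rewrite [leRHS]gee0_abs ?adde_ge0// !patchE.
have [BCx|] := boolP (x \in B `|` C); 
  last first.
  by move=> _ /=; rewrite normr0; apply: adde_ge0; exact: abse_ge0.
have [Bx|nBx] := boolP (x \in B); first by rewrite /= leeDl// abse_ge0.
suff -> : x \in C by rewrite /= leeDr// abse_ge0.
by move: BCx; rewrite in_setU (negbTE nBx).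
Qed.

Lemma exhaustion_bigsetU (F : (set X)^nat) : \bigcup_i F i = setT ->
  (forall i, A (F i)) -> exhaustion A (fun n => \big[setU/set0]_(i < n.+1) F i).
Proof.
move=> UF AF; split.
- by move=> m n mn; apply/subsetPset; exact: subset_bigsetU.
- by rewrite bigcup_bigsetU_bigcup.
- move=> n; rewrite -(sub_measurableE sA); apply: bigsetU_measurable => i _.
  by rewrite (sub_measurableE sA).
Qed.

(** The covering sets of [is_condexp] need not increase; their finite unions form an exhaustion on
    which [f] is still integrable, and [g] inherits integrability there. *)
Lemma is_condexp_clce (f g : X -> R[i]) : cmeasurable f -> is_condexp mu A f g ->
  clce f g.
Proof.
move=> [mr mi] [[mgr mgi] [F UF FE] E].
have AF i : A (F i) by have [] := FE i.
pose G n := \big[setU/set0]_(i < n.+1) F i.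
have eG : exhaustion A G by exact: exhaustion_bigsetU.
have [_ _ AG] := eG.
have iG (k : X -> \bar R) n : (forall i, mu.-integrable (F i) k) -> mu.-integrable (G n) k.
  move=> ik; rewrite /G; elim: n.+1 => [|m IH].
    by rewrite big_ord0; exact: integrable_set0.
  rewrite big_ord_recr/=; apply: integrable_setU => //; last exact: Am.
  by apply: bigsetU_measurable => i _; exact: Am.
have iGr n : mu.-integrable (G n) (EFin \o (@Re R \o f)).
  by apply: iG => i; have [_ []] := FE i.
have iGi n : mu.-integrable (G n) (EFin \o (@Im R \o f)).
  by apply: iG => i; have [_ []] := FE i.
have EG n B : A B -> B `<=` G n -> [/\ cintegrable mu B f, cintegrable mu B g &
    cintegral mu B g = cintegral mu B f].
  move=> AB BG.
  have iB : cintegrable mu B f.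
    split; [apply: integrableS (iGr n) => //|apply: integrableS (iGi n) => //];
    exact: Am.
  by have [? ?] := E B AB iB.
split.
  split => //; exists G => // n; split => //.
    by have [_ []] := EG n (G n) (AG n) (@subset_refl _ _).
  move=> B AB BG; have [[i1 _] [i2 _] H] := EG n B AB BG.
  have mB := Am AB.
  have := congr1 (fun z => (Re z)%:E) H.
  by rewrite /cintegral /Rintegral/= !fineK; [|exact: integrable_fin_num i1|exact: integrable_fin_num i2].
split => //; exists G => // n; split => //.
  by have [_ []] := EG n (G n) (AG n) (@subset_refl _ _).
move=> B AB BG; have [[_ i1] [_ i2] H] := EG n B AB BG.
have mB := Am AB.
have := congr1 (fun z => (Im z)%:E) H.
by rewrite /cintegral /Rintegral/= !fineK; [|exact: integrable_fin_num i1|exact: integrable_fin_num i2].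
Qed.

(** The integrals over sets of [A] come from [clce_glue]; the covering comes from intersecting the
    exhaustions of the real and imaginary parts. *)
Lemma clce_is_condexp (f g : X -> R[i]) : clce f g -> is_condexp mu A f g.
Proof.
move=> h; have [_ mg] := clce_cmeasurable h; split => //; last first.
  by move=> B AB iB; have [] := clce_glue h AB iB.
have [[_ _ [F eF FE]] [_ _ [G eG GE]]] := h.
have [_ UI AI] := exhaustionI sA eF eG.
have [_ _ AF] := eF; have [_ _ AG] := eG.
exists (fun i => F i `&` G i) => // i; split => //.
have [fi _ _] := FE i; have [gi _ _] := GE i.
split; [apply: integrableS fi => //|apply: integrableS gi => //]; exact: Am.
Qed.

End ComplexLocalCondexp.

(** * Positivity, strictly positive integrable functions and truncated inverses *)

Lemma lce_ge0_le0 (R : realType) d (X : measurableType d)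
    (mu : {measure set X -> \bar R}) (A : set_system X) (f g : X -> R) :
  sigma_algebra setT A -> A `<=` measurable -> lce mu A f g ->
  (forall x, 0 <= f x) -> (forall x, g x <= 0) -> {ae mu, forall x, f x = 0}.
Proof.
move=> sA Am [mf mg [F [ndF UF AF] FE]] f0 g0.
have fF i : {ae mu, forall x, F i x -> f x = 0}.
  have mF := Am _ (AF i).
  have [fi gi /(_ (F i) (AF i) (@subset_refl _ _)) E] := FE i.
  have [+ _] := ae_eq_integral_abs mu mF (measurable_int _ fi).
  (* Over [F i] the integral of [f] equals that of [g], so it is both nonnegative and
     nonpositive. *)
  have -> : (\int[mu]_(x in F i) `|(EFin \o f) x| = 0)%E.
    apply/eqP; rewrite eq_le; apply/andP; split.
      under eq_integral do rewrite /= ger0_norm//.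
      rewrite E -[leRHS](integral0 mu (F i)).
      by apply: le_integral => //; [exact: integrable0|move=> x _; rewrite lee_fin].
    exact: integral_ge0.
  by move=> /(_ erefl); apply: filterS => x /= h /h[].
have := ae_foralln fF; apply: filterS => x h.
have [i _ Fi] : (\bigcup_i F i) x by rewrite UF.
exact: h Fi.
Qed.

(** The function is the sum of [c i] times the indicator of [F i], where [c i] is [2^-(i+1)] divided
    by [1 + mu (F i)]. Both [c i] and [c i * mu (F i)] are at most [2^-(i+1)], so the sum is finite
    everywhere and its integral is at most 1. *)
Lemma sigma_finite_pos_integrable (R : realType) d (X : measurableType d)
    (mu : {sigma_finite_measure set X -> \bar R}) :
  exists q : X -> R, [/\ measurable_fun setT q, forall x, 0 < q x &
    (\int[mu]_x (q x)%:E < +oo)%E].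
Proof.
have [F UF Fm] := sigma_finiteT mu.
have mF i : measurable (F i) by case: (Fm i).
have m0 i : 0 <= fine (mu (F i)) by rewrite fine_ge0.
have [e eE] : {e : R^nat | forall i, e i = 1 / (2 ^ i.+1)%:R} by eexists.
have e0 i : 0 < e i by rewrite eE divr_gt0 ?ltr0n ?expn_gt0.
pose c i := e i / (1 + fine (mu (F i))).
have c0 i : 0 < c i by rewrite divr_gt0// ltr_wpDr.
have c1 i : c i <= e i.
  by apply: ler_piMr; [exact: ltW|rewrite invf_le1 ?lerDl// ltr_wpDr].
have cF i : ((c i)%:E * mu (F i) <= (e i)%:E)%E.
  have [_ fF] := Fm i; rewrite -[mu _]fineK ?ge0_fin_numE// -EFinM lee_fin.
  rewrite /c -mulrA; apply: ler_piMr; first exact: ltW.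
  by rewrite mulrC ler_pdivrMr ?mul1r ?lerDr// ltr_wpDr.
have esum : (\sum_(i <oo) (e i)%:E <= 1%:E)%E.
  apply: le_trans (epsilon_trick0 xpredT (@ler01 R)).
  by apply: lee_nneseries => i _; [rewrite lee_fin ltW|rewrite eE].
pose t i x : \bar R := (c i * \1_(F i) x)%:E.
have t0 i x : (0 <= t i x)%E by rewrite lee_fin mulr_ge0// ltW.
have mt i : measurable_fun setT (t i).
  by apply/measurable_EFinP; apply: measurable_funM => //; exact: measurable_indic.
pose Q x : \bar R := (\sum_(i <oo) t i x)%E.
have Q0 x : (0 <= Q x)%E by apply: nneseries_ge0.
have Qfin x : Q x \is a fin_num.
  rewrite ge0_fin_numE//; apply: (@le_lt_trans _ _ 1%:E); last exact: ltry.
  apply: le_trans esum; apply: lee_nneseries => // i _; rewrite lee_fin; apply: le_trans (c1 i).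
  by apply: ler_piMr; [exact: ltW|rewrite indicE lern1 leq_b1].
have mQ : measurable_fun setT Q.
  by apply: ge0_emeasurable_sum => // i x _ _; exact: t0.
exists (fine \o Q); split.
- by apply/measurable_EFinP; rewrite (_ : _ \o _ = Q)//; apply/funext => x /=; rewrite fineK.
- move=> x /=; rewrite -lte_fin fineK//.
  have [i _ Fi] : (\bigcup_i F i) x by rewrite -UF.
  apply: (@lt_le_trans _ _ (t i x)); first by rewrite lte_fin mulr_gt0// indicE mem_set//= ltr01.
  rewrite /Q (@nneseriesD1 _ (t^~ x) i xpredT (fun k _ => t0 k x) isT).
  by rewrite leeDl// nneseries_ge0.
- apply: (@le_lt_trans _ _ 1%:E); last exact: ltry.
  under eq_integral do rewrite /= fineK//.
  rewrite integral_nneseries//.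
  apply: le_trans esum; apply: lee_nneseries => [i *|i _]; first exact: integral_ge0.
  apply: le_trans (cF i); rewrite /t.
  under eq_integral do rewrite EFinM.
  rewrite ge0_integralZl ?integral_indic ?setIT//.
  + by apply/measurable_EFinP; exact: measurable_indic.
  + by rewrite lee_fin ltW.
Qed.

Lemma measurable_fun_posV (R : realType) d (X : measurableType d) (a : X -> R) :
  measurable_fun setT a ->
  measurable_fun setT (fun x => if 0 < a x then (a x)^-1 else 0).
Proof.
move=> ma.
have -> : (fun x => if 0 < a x then (a x)^-1 else 0) =
    (fun x => \1_[set x | 0 < a x] x * (a x) `^ (-1)).
  apply/funext => x; rewrite indicE; case: ifPn => h.
    by rewrite mem_set//= mul1r powR_inv1// ltW.
  by rewrite memNset/= ?mul0r//; exact/negP.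
apply: measurable_funM.
  apply: measurable_indic; rewrite -[X in measurable X]setTI.
  have -> : [set x | 0 < a x] = a @^-1` `]0, +oo[.
    by apply/seteqP; split => x /=; rewrite in_itv/= andbT.
  exact: ma.
exact: (measurableT_comp (measurable_powR _) ma).
Qed.

(** * Square-integrable functions and their classes in [L2] *)

Section SquareIntegrable.
Context (R : realType) d (X : measurableType d) (mu : {measure set X -> \bar R}).
Local Notation normc := (@ComplexField.Normc.normc R).

Lemma normrcE (z : R[i]) : `|z| = (normc z)%:C%C.
Proof. by []. Qed.

Lemma measurable_normc2 (f : X -> R[i]) : cmeasurable f ->
  measurable_fun setT (fun x => normc (f x) ^+ 2).
Proof.
move=> [fr fi]; under eq_fun do rewrite normc_sqr.
by apply: measurable_funD; apply: measurable_funX.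
Qed.

Lemma square_integrable_le (f g : X -> R[i]) : cmeasurable f ->
  (forall x, normc (f x) ^+ 2 <= normc (g x) ^+ 2) ->
  square_integrable mu g -> square_integrable mu f.
Proof.
move=> mf fg [mg ig]; split => //; apply: le_lt_trans ig.
apply: ge0_le_integral => //.
- by move=> x _; rewrite lee_fin sqr_ge0.
- by apply/measurable_EFinP; exact: measurable_normc2.
- by apply/measurable_EFinP; exact: measurable_normc2.
- by move=> x _; rewrite lee_fin.
Qed.

Lemma L2fun_square_integrable (f : L2fun mu) : square_integrable mu f.
Proof. by case: f => f /= /asboolP. Qed.

Lemma repr_square_integrable (F : L2 mu) : square_integrable mu (repr F).
Proof. exact: L2fun_square_integrable. Qed.

Lemma repr_L2class (f : X -> R[i]) : square_integrable mu f ->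
  {ae mu, forall x, repr (L2class mu f) x = f x}.
Proof.
move=> sf; have f2 : f \in L2pred mu by exact/asboolP.
rewrite /L2class; apply: filterS (repr_piE (insubd (0 : L2fun mu) f)) => x ->.
by have /= -> := insubdK (0 : L2fun mu) f2.
Qed.

Lemma square_integrable_cintegrable (f g : X -> R[i]) :
  square_integrable mu f -> square_integrable mu g ->
  cintegrable mu setT (fun x => f x * (g x)^*).
Proof.
move=> sf sg; have f2 : f \in L2pred mu by exact/asboolP.
have g2 : g \in L2pred mu by exact/asboolP.
exact: (L2fun_cintegrable (MkL2fun f2) (MkL2fun g2)).
Qed.

Lemma L2ip_ae (F G : L2 mu) (f g : X -> R[i]) :
  square_integrable mu f -> square_integrable mu g ->
  {ae mu, forall x, repr F x = f x} -> {ae mu, forall x, repr G x = g x} ->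
  L2ip mu F G = cintegral mu setT (fun x => f x * (g x)^*).
Proof.
move=> sf sg Ff Gg; apply: cintegral_ae.
- exact: L2fun_cintegrable.
- exact: square_integrable_cintegrable.
- by apply: filterS2 Ff Gg => x -> ->.
Qed.

Lemma mul_conjc (z : R[i]) : z * z^* = (normc z ^+ 2)%:C%C.
Proof. by rewrite -normCK normrcE -rmorphXn. Qed.

Lemma L2ipE (F : L2 mu) (f : X -> R[i]) : square_integrable mu f ->
  {ae mu, forall x, repr F x = f x} ->
  L2ip mu F F = (\int[mu]_x (normc (f x) ^+ 2))%:C%C.
Proof.
move=> sf Ff; rewrite (L2ip_ae sf sf Ff Ff) /cintegral.
apply/eqP; rewrite eq_complex; apply/andP; split; apply/eqP => /=.
  by apply: eq_Rintegral => x _; rewrite mul_conjc.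
rewrite (@eq_Rintegral _ _ _ _ _ (fun=> 0)) ?Rintegral_cst ?mul0r//.
by move=> x _; rewrite mul_conjc.
Qed.

End SquareIntegrable.

Lemma cmeasurable_real (R : realType) d (T : measurableType d) (a : T -> R) :
  measurable_fun setT a -> cmeasurable (fun x => (a x)%:C%C).
Proof. by move=> ma; split => //; exact: measurable_cst. Qed.

Lemma cmeasurable_conj (R : realType) d (T : measurableType d) (f : T -> R[i]) :
  cmeasurable f -> cmeasurable (fun x => (f x)^*%C).
Proof.
move=> [fr fi]; split.
  by rewrite (_ : _ \o _ = @Re R \o f)//; apply/funext => x /=; case: (f x).
rewrite (_ : _ \o _ = \- (@Im R \o f)); first exact: measurable_funN.
by apply/funext => x /=; case: (f x).
Qed.

Lemma normcMsq (R : realType) (z t : R[i]) :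
  ComplexField.Normc.normc (z * t) ^+ 2 =
  ComplexField.Normc.normc z ^+ 2 * ComplexField.Normc.normc t ^+ 2.
Proof. by rewrite ComplexField.Normc.normcM exprMn. Qed.

(** * The weighted conditional type operator and its iterates *)

Section Wct.
Context (R : realType) d (X : measurableType d).
Context (mu : {sigma_finite_measure set X -> \bar R}).
Context (A : set_system X) (hA : sub_sigma_finite mu A).
Context (u w : X -> R[i]) (huw : wct_weights mu A u w).
Local Notation Y := (g_sigma_algebraType A).
Local Notation normc := (@ComplexField.Normc.normc R).
Local Notation T := (wct mu A u w).

Let sA := sub_sigma_algebra_of hA.
Let Am := sub_subset_measurable hA.

Lemma clce_condexp (f : X -> R[i]) : conditionable mu A f ->
  clce mu A f (condexp mu A f).
Proof.
move=> [mf fg]; apply: is_condexp_clce => //.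
exact: (@xgetPex _ _ [set g | is_condexp mu A f g] fg).
Qed.

Lemma sub_cmeasurable (f : X -> R[i]) : cmeasurable (f : Y -> R[i]) -> cmeasurable f.
Proof. by move=> [fr fi]; split; apply: (sub_measurable_fun sA Am). Qed.

(** Frees the computation of [T F] from the chosen representative and the chosen version of the
    conditional expectation, by [clce_uniq]. *)
Lemma wct_repr (F : L2 mu) (f k : X -> R[i]) : square_integrable mu f ->
  {ae mu, forall x, repr F x = f x} -> clce mu A (u \* f) k ->
  {ae mu, forall x, repr (T F) x = w x * k x}.
Proof.
move=> sf Ff fk; have [_ _ H] := huw.
have [/clce_condexp ck sk] := H _ (repr_square_integrable F).
have kk := @clce_uniq _ _ _ _ _ sA Am (u \* repr F) (u \* f) _ _ _ ck fk.
apply: filterS2 (repr_L2class sk) (kk _) => [x -> /= ->//|].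
by apply: filterS Ff => x /= ->.
Qed.

(** Conditionability is only given for [u * f] with [f] in L^2, so one such product is built that is
    nonnegative and vanishes only where [u] does. Its conditional expectation [e] is then inverted
    by [j] almost everywhere on the set where [u] is nonzero. *)
Lemma wct_witness : exists (f0 : X -> R[i]) (e j : X -> R),
  [/\ square_integrable mu f0 /\ clce mu A (u \* f0) (fun x => (e x)%:C%C),
    measurable_fun setT (e : Y -> R) /\ measurable_fun setT (j : Y -> R),
    forall x, j x = if 0 < e x then (e x)^-1 else 0,
    {ae mu, forall x, ~~ (0 < e x) -> u x = 0} &
    square_integrable mu (fun x => w x * (e x)%:C%C)].
Proof.
have [mu_ mw H] := huw; have [ur ui] := mu_.
have [q [mq q0 iq]] := sigma_finite_pos_integrable mu.
pose p x := q x `^ 2^-1.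
have p0 x : 0 < p x by rewrite powR_gt0.
have pq x : p x ^+ 2 = q x by rewrite /p powR12_sqrt ?sqr_sqrtr// ltW.
have mp : measurable_fun setT p by exact: (measurableT_comp (measurable_powR _) mq).
(* Since [|u|^2 <= a <= a^2], dividing by [a] gives [|f0| <= p], and [p] is in L^2 because
   [p^2 = q]. *)
pose a x := 1 + normc (u x) ^+ 2.
have a0 x : 0 < a x by rewrite ltr_pwDl ?sqr_ge0.
have ma : measurable_fun setT a by apply: measurable_funD => //; exact: measurable_normc2.
have mva : measurable_fun setT (fun x => (a x)^-1).
  by have := measurable_fun_posV ma; under eq_fun do rewrite a0.
pose s x := p x * (a x)^-1.
have ms : measurable_fun setT s by exact: measurable_funM.
(* u f0 = p |u|^2 / (1 + |u|^2) *)
pose f0 x := (s x)%:C%C * (u x)^*%C.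
have sp : square_integrable mu (fun x => (p x)%:C%C).
  split; first exact: cmeasurable_real.
  by under eq_integral do rewrite normc_sqr/= expr0n addr0 pq.
have sf0 : square_integrable mu f0.
  apply: square_integrable_le sp.
    by apply: cmeasurableM; [exact: cmeasurable_real|exact: cmeasurable_conj].
  move=> x; rewrite normcMsq !normc_sqr/= expr0n !addr0 exprMn -mulrA.
  apply: ler_piMr; first exact: sqr_ge0.
  have -> : Re (u x)^*%C ^+ 2 + Im (u x)^*%C ^+ 2 = normc (u x) ^+ 2.
    by rewrite normc_sqr; case: (u x) => b c /=; rewrite sqrrN.
  rewrite exprVn mulrC ler_pdivrMr ?exprn_gt0// mul1r.
  apply: (@le_trans _ _ (a x)); first by rewrite lerDr.
  by rewrite expr2; apply: ler_peMl; [exact: ltW|rewrite lerDl sqr_ge0].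
have vE x : u x * f0 x = (s x * normc (u x) ^+ 2)%:C%C.
  by rewrite /f0 mulrCA mul_conjc -rmorphM.
have [/clce_condexp ck sk] := H _ sf0.
set E := condexp mu A (u \* f0) in ck sk.
pose e x := Re (E x).
have [[lr li] [mE1 mE2]] := (ck, (clce_cmeasurable ck).2).
have z0 : lce mu A (fun=> 0) (fun=> 0).
  have := lceM sA Am (@measurable_cst _ _ Y _ _ (0 : R)) lr.
  by congr lce; apply/funext => x /=; rewrite mul0r.
have Eim : {ae mu, forall x, Im (E x) = 0}.
  apply: (lce0_ae sA Am); apply: lce_ae li => //.
  by apply: aeW => x /=; rewrite vE.
have ecE : clce mu A (u \* f0) (fun x => (e x)%:C%C).
  split; first exact: lr.
  rewrite (_ : @Im R \o (u \* f0) = fun=> 0); first exact: z0.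
  by apply/funext => x /=; rewrite vE.
have mj := measurable_fun_posV mE1.
exists f0, e, (fun x => if 0 < e x then (e x)^-1 else 0); split => //.
(* On the set [e <= 0], which belongs to [A], the nonnegative [u * f0] has a nonpositive conditional
   expectation, so it vanishes there almost everywhere, and [|u|^2] with it. *)
- pose b x : R := \1_[set x | e x <= 0] x.
  have mb : measurable_fun setT (b : Y -> R).
    apply: measurable_indic; rewrite -[X in measurable X]setTI.
    exact: (measurable_fun_le _ _ _).
  have b0 x : 0 <= b x by rewrite /b indicE.
  have : {ae mu, forall x, (b \* (@Re R \o (u \* f0))) x = 0}.
    apply: (lce_ge0_le0 sA Am (lceM sA Am mb lr)) => x /=.
      rewrite vE/=; apply: mulr_ge0 => //; apply: mulr_ge0; last exact: sqr_ge0.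
      by rewrite ltW// divr_gt0.
    rewrite /b indicE; have [h|h] := boolP (x \in _); last by rewrite mul0r.
    by rewrite mul1r; move: h; rewrite inE.
  apply: filterS => x + ex; rewrite /= vE/= /b indicE mem_set/= ?mul1r; last first.
    by rewrite leNgt.
  move/eqP; rewrite mulf_eq0 (gt_eqF (mulr_gt0 (p0 x) _)) ?invr_gt0//= sqrf_eq0.
  by move=> /eqP; exact: ComplexField.Normc.eq0_normc.
(* As [e] is the real part of [E], the modulus of [w * e] is at most that of [w * E]. *)
- apply: square_integrable_le sk.
    apply: cmeasurableM => //; apply: cmeasurable_real.
    exact: (sub_measurable_fun sA Am).
  move=> x; rewrite !normcMsq ler_wpM2l ?sqr_ge0// [leLHS]normc_sqr [leRHS]normc_sqr.
  by rewrite /= expr0n addr0 lerDl sqr_ge0.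
Qed.

(** Since [w * e] is in L^2, [u * w * e] has a conditional expectation. Multiplying by the
    [A]-measurable [j] gives back [u * w] where [e > 0], and elsewhere [u = 0] almost everywhere. *)
Lemma wct_conditionable : conditionable mu A (u \* w).
Proof.
have [mu_ mw H] := huw.
have muw : cmeasurable (u \* w) by exact: cmeasurableM.
have [f0 [e [j [[sf0 f0e] [me mj] jE u0 swe]]]] := wct_witness.
have [/clce_condexp ck _] := H _ swe.
split => //; eexists; apply: (clce_is_condexp sA Am).
apply: clce_ae (clceM sA Am (cmeasurable_real mj) ck) => //.
apply: filterS u0 => x /=; rewrite jE; case: ifPn => e0 h.
  rewrite mulrCA; congr (_ * _); rewrite mulrCA -rmorphM/= mulVf ?mulr1//.
  by rewrite gt_eqF.
by rewrite mul0r h// mul0r.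
Qed.

Local Notation c := (condexp mu A (u \* w)).

(** Here [T F = w * k] with [k] measurable for [A]; pulling [k] out of the conditional expectation
    of [u * w * k] leaves [k * c]. *)
Lemma wct_wct (F : L2 mu) :
  {ae mu, forall x, repr (T (T F)) x = c x * repr (T F) x}.
Proof.
have [_ _ H] := huw.
have [/clce_condexp ck sk] := H _ (repr_square_integrable F).
have cc := clce_condexp wct_conditionable.
set k := condexp mu A (u \* repr F) in ck sk.
have TF : {ae mu, forall x, repr (T F) x = w x * k x} by exact: repr_L2class.
have mk := (clce_cmeasurable ck).2.
have uk : clce mu A (u \* (w \* k)) (k \* c).
  have := clceM sA Am mk cc; congr clce; apply/funext => x /=.
  by rewrite mulrC mulrA.
by apply: filterS2 TF (wct_repr sk TF uk) => x -> -> /=; rewrite mulrA mulrC.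
Qed.

(** The exponent is one less than the number of iterations because the factor [c] appears only from
    the second application of [T] on. *)
Lemma wct_iter (F : L2 mu) n : {ae mu, forall x,
  repr (iter n.+1 T F) x = c x ^+ n * repr (T F) x}.
Proof.
elim: n => [|n IH]; first by apply: aeW => x; rewrite expr0 mul1r.
apply: filterS2 IH (wct_wct (iter n T F)) => x /= IH ->.
by rewrite IH mulrA exprS.
Qed.

Lemma wct_iterS (F : L2 mu) n : {ae mu, forall x,
  repr (iter n.+2 T F) x = c x * repr (iter n.+1 T F) x}.
Proof. exact: wct_wct. Qed.

End Wct.

Lemma normc_nneg (R : realType) (z : R[i]) : 0 <= ComplexField.Normc.normc z.
Proof. by case: z => a b; exact: sqrtr_ge0. Qed.

(** * Norm inequalities in [L2] *)

Section L2Norm.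
Context (R : realType) d (X : measurableType d) (mu : {measure set X -> \bar R}).
Local Notation normc := (@ComplexField.Normc.normc R).

Definition L2sqnorm (F : L2 mu) : R := \int[mu]_x (normc (repr F x) ^+ 2).

Lemma L2ip_sqnorm (F : L2 mu) : L2ip mu F F = (L2sqnorm F)%:C%C.
Proof. by apply: (L2ipE (repr_square_integrable F)); exact: aeW. Qed.

Lemma normc2_integrable (f : X -> R[i]) : square_integrable mu f ->
  mu.-integrable setT (fun x => (normc (f x) ^+ 2)%:E).
Proof.
move=> [mf fi]; apply/integrableP; split.
  by apply/measurable_EFinP; exact: measurable_normc2.
by under eq_integral do rewrite gee0_abs ?lee_fin ?sqr_ge0//.
Qed.

Lemma adjoint_iter (T S : L2 mu -> L2 mu) n x y : is_adjoint (L2ip mu) T S ->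
  L2ip mu (iter n T x) y = L2ip mu x (iter n S y).
Proof.
move=> TS; have {}TS F G : L2ip mu (T F) G = L2ip mu F (S G) by exact: TS.
by elim: n x y => [//|n IH] x y; rewrite [iter n.+1 T x]/= TS IH -iterSr.
Qed.

(** The inner product of [S^k T^k F] with [F] is the squared norm of [T^k F]. *)
Lemma op_le_sqnorm (T S : L2 mu -> L2 mu) m n : is_adjoint (L2ip mu) T S ->
  op_le (L2ip mu) (iter m S \o iter m T) (iter n S \o iter n T) <->
  forall F, L2sqnorm (iter m T F) <= L2sqnorm (iter n T F).
Proof.
move=> TS.
have E k F : L2ip mu (iter k S (iter k T F)) F = (L2sqnorm (iter k T F))%:C%C.
  by rewrite L2ip_conj -(adjoint_iter _ _ _ TS) L2ip_sqnorm conjc_real.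
have D F : L2ip mu (iter n S (iter n T F) - iter m S (iter m T F)) F =
    (L2sqnorm (iter n T F) - L2sqnorm (iter m T F))%:C%C.
  by rewrite linearBl/= !E rmorphB.
by split=> H F; have := H F; rewrite /op_le /= D lecR subr_ge0.
Qed.

Lemma dot_le_sqnorm (F G : L2 mu) (K N : R) : 0 < K ->
  L2sqnorm F <= K * N -> L2ip mu F G = N%:C%C -> N <= K * L2sqnorm G.
Proof.
move=> K0 FN FG.
(* |F - K G|^2 >= 0; the library has Cauchy-Schwarz only in finite dimension. *)
have : 0 <= L2ip mu (F - K%:C%C *: G) (F - K%:C%C *: G) by exact: dnorm_ge0.
have cr (a : R) : Num.conj (a%:C%C : R[i]) = a%:C%C by exact: conjc_real.
have EB (P Q : L2 mu) : L2ip mu (P - Q) (P - Q) =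
    L2ip mu P P + L2ip mu Q Q - (L2ip mu P Q + Num.conj (L2ip mu P Q)).
  exact: dnormB.
have EZ : L2ip mu (K%:C%C *: G) (K%:C%C *: G) = `|K%:C%C| ^+ 2 * L2ip mu G G.
  exact: dnormZ.
have EV : L2ip mu F (K%:C%C *: G) = (K * N)%:C%C.
  have -> : (K * N)%:C%C = Num.conj K%:C%C * N%:C%C by rewrite cr; exact: rmorphM.
  by rewrite -FG; exact: linearZr_LR.
rewrite EB EZ EV cr !L2ip_sqnorm normrcE -rmorphXn normc_sqr/= expr0n addr0.
rewrite -rmorphM -!rmorphD -rmorphB lecR/=.
(* The expansion reads [|F|^2 + K^2 |G|^2 - 2 K N >= 0], and [|F|^2 <= K N]. *)
move=> h; have {h} : K * N <= K * (K * L2sqnorm G) by lra.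
by rewrite ler_pM2l.
Qed.

(** The difference of the squared moduli is nonnegative almost everywhere with integral at most
    zero, so it vanishes almost everywhere. *)
Lemma le_sqnorm_ae_eq (F G : L2 mu) :
  {ae mu, forall x, normc (repr F x) <= normc (repr G x)} ->
  L2sqnorm G <= L2sqnorm F ->
  {ae mu, forall x, normc (repr F x) = normc (repr G x)}.
Proof.
move=> FG GF.
have iF := normc2_integrable (repr_square_integrable F).
have iG := normc2_integrable (repr_square_integrable G).
pose D x := normc (repr G x) ^+ 2 - normc (repr F x) ^+ 2.
have iD : mu.-integrable setT (EFin \o D).
  rewrite (_ : _ \o _ = ((fun x => (normc (repr G x) ^+ 2)%:E) \-
    (fun x => (normc (repr F x) ^+ 2)%:E))%E); last first.
    by apply/funext => x /=; rewrite EFinB.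
  exact: integrableB.
have D0 : {ae mu, forall x, 0 <= D x}.
  by apply: filterS FG => x FGx; rewrite subr_ge0 ler_sqr ?nnegrE ?normc_nneg.
have ID : (\int[mu]_x (D x)%:E <= 0)%E.
  rewrite -[X in (X <= _)%E]fineK; last exact: integrable_fin_num.
  have E : fine (\int[mu]_x (D x)%:E)%E = L2sqnorm G - L2sqnorm F.
    exact: (RintegralB measurableT (f1 := fun x => normc (repr G x) ^+ 2)
      (f2 := fun x => normc (repr F x) ^+ 2)).
  by rewrite lee_fin E subr_le0.
have [+ _] := ae_eq_integral_abs mu measurableT (measurable_int _ iD).
have -> : (\int[mu]_x `|(EFin \o D) x| = 0)%E.
  apply/eqP; rewrite eq_le integral_ge0// andbT.
  apply: le_trans ID; rewrite le_eqVlt; apply/orP; left; apply/eqP.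
  apply: ae_eq_integral => //.
  - by apply: measurableT_comp => //; exact: measurable_int iD.
  - exact: measurable_int iD.
  - by apply: filterS D0 => x Dx _ /=; rewrite ger0_norm.
move=> /(_ erefl); apply: filterS => x /= /(_ I)[] /eqP.
by rewrite subr_eq0 eqrXn2 ?normc_nneg// => /eqP.
Qed.

Lemma bounded_operator_sqnorm (T : L2 mu -> L2 mu) :
  bounded_operator (L2ip mu) T ->
  exists2 K : R, 0 < K & forall F, L2sqnorm (T F) <= K * L2sqnorm F.
Proof.
(* The summand 1 keeps the constant positive even if [M = 0]; [dot_le_sqnorm] cancels it. *)
move=> [_ [M TM]]; exists (M ^+ 2 + 1); first by rewrite ltr_wpDl ?sqr_ge0.
move=> F; have := TM F; rewrite /hnorm => h.
have n0 (G : L2 mu) : 0 <= L2ip mu G G by exact: dnorm_ge0.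
have {h} : L2ip mu (T F) (T F) <= M%:C%C ^+ 2 * L2ip mu F F.
  have : sqrtC (L2ip mu (T F) (T F)) ^+ 2 <= (M%:C%C * sqrtC (L2ip mu F F)) ^+ 2.
    rewrite ler_sqr ?nnegrE ?sqrtC_ge0//.
    by apply: le_trans h; rewrite sqrtC_ge0.
  by rewrite exprMn !sqrtCK.
rewrite !L2ip_sqnorm -rmorphXn -rmorphM lecR => /le_trans; apply.
rewrite ler_wpM2r ?lerDl//.
by have := n0 F; rewrite L2ip_sqnorm lecR.
Qed.

End L2Norm.

(** * The bound on [c] against the norm inequality, and the adjoint *)

Section WctQuasiContraction.
Context (R : realType) d (X : measurableType d).
Context (mu : {sigma_finite_measure set X -> \bar R}).
Context (A : set_system X) (hA : sub_sigma_finite mu A).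
Context (u w : X -> R[i]) (huw : wct_weights mu A u w).
Local Notation Y := (g_sigma_algebraType A).
Local Notation normc := (@ComplexField.Normc.normc R).
Local Notation T := (wct mu A u w).
Local Notation c := (condexp mu A (u \* w)).

Let sA := sub_sigma_algebra_of hA.
Let Am := sub_subset_measurable hA.

Lemma quasi_contraction_condexp_le1 n : quasi_contraction (L2ip mu) n.+1 T ->
  {ae mu, forall x, `|c x| <= 1}.
Proof.
move=> [S TS] /(op_le_sqnorm _ _ TS) Tle.
have [f0 [e [j [[sf0 f0e] [me mj] jE u0 swe]]]] := wct_witness hA huw.
have cc := clce_condexp hA (wct_conditionable hA huw).
have [muw mc] := clce_cmeasurable cc.
(* This is the set where [|c| > 1], to be shown null. *)
pose Q : set X := [set x | 1 < normc (c x) ^+ 2].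
pose b x : R[i] := (\1_Q x)%:C%C.
have mb : cmeasurable (b : Y -> R[i]).
  apply: cmeasurable_real; apply: measurable_indic; rewrite -[X in measurable X]setTI.
  have -> : Q = (fun x => normc (c x) ^+ 2) @^-1` `]1, +oo[.
    by apply/seteqP; split => x /=; rewrite in_itv/= andbT.
  exact: (measurable_normc2 mc).
have bQ x : Q x -> b x = 1 by move=> Qx; rewrite /b indicE mem_set.
have bNQ x : ~ Q x -> b x = 0 by move=> Qx; rewrite /b indicE memNset.
have sbf : square_integrable mu (b \* f0).
  apply: square_integrable_le (sf0).
    by apply: cmeasurableM; [exact: (sub_cmeasurable hA)|case: sf0].
  move=> x /=; have [Qx|Qx] := pselect (Q x); first by rewrite bQ// mul1r.
  by rewrite bNQ// mul0r ComplexField.Normc.normc0 expr0n sqr_ge0.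
pose G := L2class mu (b \* f0).
have GE := repr_L2class sbf.
have ubf : clce mu A (u \* (b \* f0)) (b \* (fun x => (e x)%:C%C)).
  have := clceM sA Am mb f0e; congr clce; apply/funext => x /=.
  by rewrite mulrCA.
have TG := wct_repr hA huw sbf GE ubf.
(* [Phi] is [T^(n+1) G], which equals [c^n * w * b * e] and so vanishes off [Q]. *)
have [Phi [PhiE TPhiE lePhi]] : exists Phi : L2 mu,
    [/\ {ae mu, forall x, repr Phi x = c x ^+ n * repr (T G) x},
     {ae mu, forall x, repr (T Phi) x = c x * repr Phi x} &
     L2sqnorm (T Phi) <= L2sqnorm Phi].
  exists (iter n.+1 T G); split; [exact: wct_iter|exact: wct_iterS|exact: Tle].
have cQ x : Q x -> 1 < normc (c x).
  by rewrite /Q/= -[ltLHS](expr1n _ 2) ltr_sqr ?nnegrE ?normc_nneg.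
(* On [Q] multiplication by [c] enlarges the modulus; off [Q] both sides are zero. With [lePhi] this
   forces equality almost everywhere. *)
have le_ae : {ae mu, forall x, normc (repr Phi x) <= normc (repr (T Phi) x)}.
  apply: filterS3 TG PhiE TPhiE => x TGx Phix TPhix.
  rewrite -> TPhix; rewrite ComplexField.Normc.normcM.
  have [Qx|Qx] := pselect (Q x); first by rewrite ler_peMl ?normc_nneg// ltW// cQ.
  by rewrite Phix TGx /= bNQ// mul0r !mulr0 ComplexField.Normc.normc0 mulr0.
have eq_ae := le_sqnorm_ae_eq le_ae lePhi.
(* On [Q], [|Phi| = |c| |Phi|] with [|c| > 1] gives [Phi = 0], and [c^n] cancels because [c] is
   nonzero there. *)
have bw0 : {ae mu, forall x, b x * w x * (e x)%:C%C = 0}.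
  apply: filterS2 eq_ae (filterI TG (filterI PhiE TPhiE)) => x + [TGx [Phix TPhix]].
  rewrite -> TPhix.
  have [Qx|Qx] := pselect (Q x); last by rewrite bNQ// !mul0r.
  rewrite ComplexField.Normc.normcM => /eqP.
  have := cQ _ Qx => c1.
  rewrite -subr_eq0 -[X in X - _]mul1r -mulrBl mulf_eq0 subr_eq0 lt_eqF//=.
  move=> /eqP /ComplexField.Normc.eq0_normc; rewrite Phix TGx /= => /eqP.
  have c0 : c x != 0.
    apply/eqP => c0; move: c1.
    by rewrite c0 ComplexField.Normc.normc0 ltNge ler01.
  by rewrite mulf_eq0 expf_eq0 (negbTE c0) andbF/= => /eqP <-; rewrite bQ// !mul1r.
(* On [Q] the product [u * w] is zero: by [u0] where [e <= 0], by [bw0] where [e > 0]. *)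
have buw0 : {ae mu, forall x, (b \* (u \* w)) x = (cst 0 \* (u \* w)) x}.
  apply: filterS2 u0 bw0 => x u0 bw0; rewrite /= mul0r mulrCA.
  have [e0|e0] := boolP (0 < e x); last by rewrite u0// mul0r.
  move/eqP: bw0; rewrite mulf_eq0 => /orP[/eqP ->|]; first by rewrite mulr0.
  by rewrite eq_complex/= gt_eqF.
have mz : cmeasurable (cst 0 : Y -> R[i]) by exact: (@cmeasurable_real _ _ Y (cst 0)).
(* By uniqueness [b * c = 0] almost everywhere, so [c = 0] on almost all of [Q], against
   [|c| > 1]. *)
have := clce_uniq sA Am buw0 (clceM sA Am mb cc) (clceM sA Am mz cc).
apply: filterS => x /=; rewrite mul0r => bc0.
have nQ : ~ Q x.
  move=> Qx; move: bc0; rewrite bQ// mul1r => c0; move: (cQ _ Qx).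
  by rewrite c0 ComplexField.Normc.normc0 ltNge ler01.
rewrite normrcE (_ : 1 = 1%:C%C)// lecR; move/negP: nQ; rewrite -leNgt.
by rewrite -[leRHS](expr1n _ 2) ler_sqr ?nnegrE ?normc_nneg.
Qed.

(** Integrates the pointwise relation [T^(n+2) F = c * T^(n+1) F]. The adjoint is a parameter
    because [quasi_contraction] asks for one. *)
Lemma condexp_le1_quasi_contraction n S : is_adjoint (L2ip mu) T S ->
  {ae mu, forall x, `|c x| <= 1} -> quasi_contraction (L2ip mu) n.+1 T.
Proof.
move=> TS c1; exists S => //; apply/(op_le_sqnorm _ _ TS) => F.
have i2 := normc2_integrable (repr_square_integrable (iter n.+2 T F)).
have i1 := normc2_integrable (repr_square_integrable (iter n.+1 T F)).
apply: fine_le; [exact: integrable_fin_num i2|exact: integrable_fin_num i1|].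
apply: ae_ge0_le_integral => //.
- by move=> x _; rewrite lee_fin sqr_ge0.
- exact: measurable_int i2.
- by move=> x _; rewrite lee_fin sqr_ge0.
- exact: measurable_int i1.
apply: filterS2 c1 (wct_iterS hA huw F n) => x c1 -> _.
rewrite lee_fin normcMsq ler_piMl ?sqr_ge0//.
by move: c1; rewrite normrcE (_ : 1 = 1%:C%C)// lecR => c1; rewrite expr_le1 ?normc_nneg.
Qed.

(** The adjoint at [G] is the class of [h], the conjugate of [u * W]. The identity is first proved
    for [f] with [W * u * f] integrable, then tested on truncations of [h] to put [h] in L^2, after
    which it holds for every [F]. *)
Lemma wct_adjoint_at (G : L2 mu) : bounded_operator (L2ip mu) T ->
  exists H, forall F, L2ip mu (T F) G = L2ip mu F H.
Proof.
move=> /bounded_operator_sqnorm[K K0 TK].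
have [f0 [e [j [[sf0 f0e] [me mj] jE u0 swe]]]] := wct_witness hA huw.
have [[ur ui] [wr wi] Hw] := huw.
set g : X -> R[i] := repr G.
have sg : square_integrable mu g by exact: repr_square_integrable.
have [mg _] := sg.
pose ec x : R[i] := (e x)%:C%C; pose jc x : R[i] := (j x)%:C%C.
(* Both [w * e] and [g] are in L^2, so [w] times [e] times the conjugate of [g] is integrable over
   [X] and has a conditional expectation. *)
have [vr vi] := square_integrable_cintegrable swe sg.
have [Vr lr] := lce_exists hA vr; have [Vi li] := lce_exists hA vi.
pose v x := w x * ec x * (g x)^*.
pose V x : R[i] := (Vr x +i* Vi x)%C.
have vV : clce mu A v V by [].
have mjc : cmeasurable (jc : Y -> R[i]) by exact: cmeasurable_real.
have mec : cmeasurable (ec : Y -> R[i]) by exact: cmeasurable_real.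
have je x : 0 < e x -> jc x * ec x = 1.
  by move=> e0; rewrite /jc /ec -rmorphM/= jE e0 mulVf// gt_eqF.
(* W is E(w conj(g)) on {e > 0}, and 0 elsewhere. *)
pose W := jc \* V.
have vW : clce mu A (jc \* v) W by exact: clceM.
have mW := (clce_cmeasurable vW).2.
have AT : A setT by rewrite -(sub_measurableE sA).
(* With [k] the conditional expectation of [u * f], pulling out [k] equates the inner product with
   the integral of [k * W], and pulling out [W] equates this with the integral of [W * u * f]. *)
have adj (F : L2 mu) (f : X -> R[i]) : square_integrable mu f ->
    {ae mu, forall x, repr F x = f x} ->
    cintegrable mu setT (W \* (u \* f)) ->
    L2ip mu (T F) G = cintegral mu setT (W \* (u \* f)).
  move=> sf Ff iW; have [cu sk] := Hw _ sf; have ck := clce_condexp hA cu.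
  set k := condexp mu A (u \* f) in ck sk.
  have mk := (clce_cmeasurable ck).2.
  have TF := wct_repr hA huw sf Ff ck.
  rewrite (L2ip_ae sk sg TF (aeW _ (fun=> erefl))).
  have [_ <-] := clce_glue sA Am (clceM sA Am mW ck) AT iW.
  (* Almost everywhere [k] vanishes where [e] is not positive, because [u] does: [j * e * k] and [k]
     are conditional expectations of functions that agree almost everywhere. *)
  have kje : {ae mu, forall x, (jc x * ec x) * k x = k x}.
    have mje : cmeasurable ((jc \* ec) : Y -> R[i]) by exact: cmeasurableM.
    apply: (clce_uniq sA Am _ (clceM sA Am mje ck) ck).
    apply: filterS u0 => x /=; have [e0 _|e0 ->//] := boolP (0 < e x).
      by rewrite je// mul1r.
    by rewrite !mul0r mulr0.
  have iwk := square_integrable_cintegrable sk sg.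
  have kW : clce mu A (fun x => w x * k x * (g x)^*) (k \* W).
    apply: (clce_ae Am) (clceM sA Am mk vW).
      apply: (@cmeasurableM _ _ _ (w \* k) (fun x => (g x)^*%C)).
        by apply: cmeasurableM => //; exact: (sub_cmeasurable hA).
      exact: cmeasurable_conj.
    apply: filterS kje => x kx; rewrite -[in RHS]kx /= /v.
    by set gx := (g x)^*; ring.
  have [_ <-] := clce_glue sA Am kW AT iwk.
  by congr cintegral; apply/funext => x /=; rewrite mulrC.
pose h x := (u x * W x)^*%C.
have mh : cmeasurable h.
  by apply: cmeasurable_conj; apply: (@cmeasurableM _ _ _ u W) => //;
    exact: (sub_cmeasurable hA).
have [q [mq q0 iq]] := sigma_finite_pos_integrable mu.
have mh2 := measurable_normc2 mh.
(* On D n the function |h|^2 is dominated by n q, so its truncation is in L^2. *)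
pose D (n : nat) : set X := [set x | normc (h x) ^+ 2 <= n%:R * q x].
have mD n : measurable (D n).
  rewrite -[X in measurable X]setTI; apply: (measurable_fun_le _ _ _) => //.
  exact: measurable_funM.
have ndD : nondecreasing_seq D.
  move=> m n mn; apply/subsetPset => x /= /le_trans; apply.
  by rewrite ler_wpM2r ?ler_nat// ltW.
have UD : \bigcup_n D n = setT.
  apply/seteqP; split => // x _.
  exists (Num.truncn (normc (h x) ^+ 2 / q x)).+1 => //.
  by have := truncnS_gt (normc (h x) ^+ 2 / q x); rewrite ltr_pdivrMr// => /ltW.
have hW x : W x * (u x * h x) = (normc (h x) ^+ 2)%:C%C.
  by rewrite -mul_conjc (_ : (h x)^* = u x * W x); [ring|exact: conjcK].
(* For [F] the truncation of [h] to [D n], the inner product of [T F] with [G] is the squared norm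
   of [F]. *)
have hD n : (\int[mu]_(x in D n) (normc (h x) ^+ 2)%:E <= (K * L2sqnorm G)%:E)%E.
  pose b x : R[i] := (\1_(D n) x)%:C%C.
  have bD x : D n x -> b x = 1 by move=> Dx; rewrite /b indicE mem_set.
  have bND x : ~ D n x -> b x = 0 by move=> Dx; rewrite /b indicE memNset.
  have mb : cmeasurable b by apply: cmeasurable_real; exact: measurable_indic.
  have nb x : normc ((b \* h) x) ^+ 2 = ((fun x => normc (h x) ^+ 2) \_ (D n)) x.
    rewrite patchE; case: ifPn => [|] Dx /=.
      by rewrite bD ?mul1r//; rewrite inE in Dx.
    rewrite bND ?mul0r ?ComplexField.Normc.normc0 ?expr0n//.
    by move: Dx; rewrite notin_setE.
  have nbE : (\int[mu]_x (normc ((b \* h) x) ^+ 2)%:E =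
      \int[mu]_(x in D n) (normc (h x) ^+ 2)%:E)%E.
    rewrite [RHS]integral_mkcond; apply: eq_integral => x _.
    by rewrite nb restrict_EFin.
  have sbh : square_integrable mu (b \* h).
    split; first exact: cmeasurableM.
    apply: (@le_lt_trans _ _ (\int[mu]_x (n%:R%:E * (q x)%:E))%E).
      apply: ge0_le_integral => //.
      - by move=> x _; rewrite lee_fin sqr_ge0.
      - by apply/measurable_EFinP; apply: measurable_normc2; exact: cmeasurableM.
      - by apply/measurable_EFinP; exact: measurable_funM.
      - move=> x _; rewrite lee_fin nb patchE; case: ifPn => [|_].
          by rewrite inE.
        by rewrite mulr_ge0// ltW.
    rewrite ge0_integralZl//; last 2 first.
    - by apply/measurable_EFinP.
    - by move=> x _; rewrite lee_fin ltW.
    by rewrite lte_mul_pinfty// ltry.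
  pose F := L2class mu (b \* h).
  have FE := repr_L2class sbh.
  have E x : (W \* (u \* (b \* h))) x = (normc ((b \* h) x) ^+ 2)%:C%C.
    have [Dx|Dx] := pselect (D n x).
      by rewrite /= bD// mul1r hW.
    by rewrite /= bND// mul0r ComplexField.Normc.normc0 !mulr0 expr0n.
  have ib := normc2_integrable sbh.
  have iE : cintegrable mu setT (W \* (u \* (b \* h))).
    split.
      rewrite (_ : _ \o _ = fun x => (normc ((b \* h) x) ^+ 2)%:E)//.
      by apply/funext => x; exact: (congr1 (fun z => (Re z)%:E) (E x)).
    rewrite (_ : _ \o _ = cst 0%E); first exact: integrable0.
    by apply/funext => x; exact: (congr1 (fun z => (Im z)%:E) (E x)).
  have FG : L2ip mu (T F) G = (L2sqnorm F)%:C%C.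
    rewrite (adj _ _ sbh FE iE) -L2ip_sqnorm (L2ipE sbh FE).
    rewrite /cintegral; congr (_ +i* _)%C.
      by apply: eq_Rintegral => x _; rewrite E.
    rewrite (@eq_Rintegral _ _ _ _ _ (fun=> 0)) ?Rintegral_cst ?mul0r//.
    by move=> x _; rewrite E.
  (* From [|T F|^2 <= K |F|^2] follows [|F|^2 <= K |G|^2], a bound independent of [n]. *)
  have := dot_le_sqnorm K0 (TK F) FG.
  have FF := L2ipE sbh FE; rewrite L2ip_sqnorm in FF.
  have -> : L2sqnorm F = \int[mu]_x (normc ((b \* h) x) ^+ 2).
    exact: (congr1 (@Re R) FF).
  by rewrite -lee_fin /Rintegral fineK ?nbE//; rewrite -nbE; exact: integrable_fin_num.
(* The sets [D n] increase to [X], so monotone convergence carries the uniform bound over to [h]. *)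
have sh : square_integrable mu h.
  split => //; apply: (@le_lt_trans _ _ (K * L2sqnorm G)%:E); last exact: ltry.
  have cv : (\int[mu]_(x in D n) (normc (h x) ^+ 2)%:E @[n --> \oo] -->
      \int[mu]_x (normc (h x) ^+ 2)%:E)%E.
    rewrite -UD; apply: ge0_nondecreasing_set_cvg_integral => // [n|n x _].
      by apply/measurable_EFinP; exact: measurable_funTS.
    by rewrite lee_fin sqr_ge0.
  rewrite -(cvg_lim _ cv)//; apply: lime_le; first by apply/cvg_ex; eexists; exact: cv.
  exact: nearW.
exists (L2class mu h) => F.
have sF := repr_square_integrable F.
have FE : {ae mu, forall x, repr F x = repr F x} by exact: aeW.
have WE : (W \* (u \* repr F)) = (fun x => repr F x * (h x)^*).
  apply/funext => x; rewrite /h /= (_ : (_^*%C)^* = u x * W x); last exact: conjcK.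
  by ring.
rewrite (L2ip_ae sF sh FE (repr_L2class sh)) -WE; apply: adj => //.
by rewrite WE; exact: square_integrable_cintegrable.
Qed.

Lemma wct_adjoint : bounded_operator (L2ip mu) T ->
  exists S, is_adjoint (L2ip mu) T S.
Proof.
move=> hT; have [S HS] := choice (fun G => wct_adjoint_at G hT).
by exists S => F G; exact: HS.
Qed.

End WctQuasiContraction.

Unset Implicit Arguments.
Set Strict Implicit.
Set Printing Implicit Defensive.

Theorem theorem2p2 (R : realType) (d : measure_display) (X : measurableType d)
    (mu : {sigma_finite_measure set X -> \bar R}) (A : set_system X)
    (hA : sub_sigma_finite mu A)
    (u w : X -> R[i]) (huw : wct_weights mu A u w)
    (hT : bounded_operator (L2ip mu) (wct mu A u w))
    (n : nat) (hn : (0 < n)%N) :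
  let T := wct mu A u w in
  [<-> quasi_contraction (L2ip mu) n T;
       quasi_contraction (L2ip mu) 1 T;
       conditionable mu A (u \* w) /\
         {ae mu, forall x, `|condexp mu A (u \* w) x| <= 1}].
Proof.
(* From here on [n] is the original exponent minus one. *)
move=> T; case: n hn => [//|n _].
have [S TS] := wct_adjoint hA huw hT.
tfae.
(* The passage from exponent [n.+1] to exponent 1 goes through the bound on [c]. *)
- move=> /(quasi_contraction_condexp_le1 hA huw).
  exact: (condexp_le1_quasi_contraction hA huw).
- move=> /(quasi_contraction_condexp_le1 hA huw) c1; split => //.
  exact: (wct_conditionable hA huw).
- by move=> [_]; exact: (condexp_le1_quasi_contraction hA huw).
Qed.
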